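(* Let $X:\Sigma^n\to\mathbb{R}^{n+1}$ be a complete and connected $\lambda$-self-shrinker for the mean curvature flow (MCF) with respect to $\vec 0\in\mathbb{R}^{n+1}$, with $\lambda>0$. Suppose that $\Sigma^n$ is parabolic and that $X(\Sigma)$ is contained in the closed ball $\{x\in\mathbb{R}^{n+1}:\|x\|\le R\}$ with $R\le\sqrt{\frac n\lambda}$. Then $\Sigma^n$ is isometric to the round sphere $S^n\big(\sqrt{\tfrac n\lambda}\big)$ of radius $\sqrt{\frac n\lambda}$.
   Context: A complete isometric immersion $X:\Sigma^n\to\mathbb{R}^{n+1}$ of an $n$-dimensional Riemannian manifold is a $\lambda$-self-shrinker for the MCF with respect to $\vec 0$ if $\lambda>0$ and $\vec H=-\lambda X^\perp$, where $\vec H$ is the mean curvature vector of $X$ (the trace of the second fundamental form, so $\vec H=\Delta^\Sigma X$) and $X^\perp$ is the component of the position vector $X$ normal to $\Sigma$. A complete Riemannian manifold $M$ is parabolic if every continuous subharmonic function $u:M\to\mathbb{R}$ ($\Delta u\ge 0$ when $u\in C^2$) with $\sup_M u<\infty$ is constant (compact manifolds have this property by the strong maximum principle).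
   Formalization: The dimension is assumed to be n ≥ 2: for n = 1 the claim fails, since the line covering the circle of radius √(1/λ) is a complete, connected, parabolic λ-self-shrinker inside the ball but is not isometric to that circle. *)

(* Defs.v *)
From HB Require Import structures.
From mathcomp Require Import all_boot all_order all_algebra.
From mathcomp Require Import all_classical all_reals all_analysis.

Set Implicit Arguments.
Unset Strict Implicit.
Unset Printing Implicit Defensive.

Import Order.TTheory GRing.Theory Num.Theory.
Import numFieldNormedType.Exports.

Local Open Scope classical_set_scope.
Local Open Scope ring_scope.

(* Points of R^n are row vectors.  The library norm on 'rV[R]_n is the sup
   norm: it is used only for its topology and its derivatives, and the
   Euclidean norm is [enorm]. *)

Definition dot (R : realType) (n : nat) (u v : 'rV[R]_n) : R :=
  \sum_(i < n) u 0 i * v 0 i.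

Definition enorm (R : realType) (n : nat) (u : 'rV[R]_n) : R :=
  Num.sqrt (dot u u).

Definition euclidean_sphere (R : realType) (n : nat) (r : R) :
    set 'rV[R]_n.+1 :=
  [set y | enorm y = r].

Definition partial (R : realType) (n : nat) (V : normedModType R)
    (i : 'I_n) (f : 'rV[R]_n -> V) (x : 'rV[R]_n) : V :=
  'D_(delta_mx 0 i) f x.

(* Meant for open U. *)
Fixpoint Ck_on (R : realType) (n : nat) (V : normedModType R) (k : nat)
    (U : set 'rV[R]_n) (f : 'rV[R]_n -> V) : Prop :=
  match k with
  | 0%N => forall x, U x -> {for x, continuous f}
  | k'.+1 => (forall x, U x -> differentiable f x) /\
             (forall i : 'I_n, Ck_on k' U (partial i f))
  end.

Definition smooth_on (R : realType) (n : nat) (V : normedModType R)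
    (U : set 'rV[R]_n) (f : 'rV[R]_n -> V) : Prop :=
  forall k, Ck_on k U f.

(* A homeomorphism from the open set [chart_dom] onto the open set
   [chart_cod]; outside of these sets the values of the two maps are junk. *)
Record chart (R : realType) (n : nat) (M : topologicalType) := Chart {
  chart_dom : set M;
  chart_map : M -> 'rV[R]_n;
  chart_inv : 'rV[R]_n -> M;
  chart_cod := chart_map @` chart_dom;
  chart_dom_open : open chart_dom;
  chart_cod_open : open chart_cod;
  chart_mapK : forall p, chart_dom p -> chart_inv (chart_map p) = p;
  chart_map_continuous :
    forall p, chart_dom p -> {for p, continuous chart_map};
  chart_inv_continuous :
    forall x, chart_cod x -> {for x, continuous chart_inv}
}.

Definition transition (R : realType) (n : nat) (M : topologicalType)
    (c d : chart R n M) : 'rV[R]_n -> 'rV[R]_n :=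
  chart_map d \o chart_inv c.

Definition overlap (R : realType) (n : nat) (M : topologicalType)
    (c d : chart R n M) : set 'rV[R]_n :=
  chart_map c @` (chart_dom c `&` chart_dom d).

(* The atlas need not be maximal; [chart_at] only selects a chart around each
   point, and the geometric quantities below do not depend on it. *)
Record smoothManifold (R : realType) (n : nat) := SmoothManifold {
  man_carrier :> topologicalType;
  man_hausdorff : hausdorff_space man_carrier;
  man_second_countable : @second_countable man_carrier;
  man_index : Type;
  man_chart : man_index -> chart R n man_carrier;
  chart_at : man_carrier -> man_index;
  chart_at_dom : forall p, chart_dom (man_chart (chart_at p)) p;
  man_compatible : forall a b,
    smooth_on (overlap (man_chart a) (man_chart b))
              (transition (man_chart a) (man_chart b))
}.

(* [metric a x] is the Gram matrix of the coordinate frame of the chart a at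
   the point of coordinates x.  Row i of the library Jacobian 'J f x is the
   i-th partial derivative of f. *)
Record riemannianManifold (R : realType) (n : nat) := RiemannianManifold {
  riem_man :> smoothManifold R n;
  metric : man_index riem_man -> 'rV[R]_n -> 'M[R]_n;
  metric_smooth : forall a (i j : 'I_n),
    smooth_on (chart_cod (man_chart a)) (fun x => metric a x i j : R);
  metric_sym : forall a x, chart_cod (man_chart a) x ->
    (metric a x)^T = metric a x;
  metric_posdef : forall a x, chart_cod (man_chart a) x ->
    forall v : 'rV[R]_n, v != 0 -> 0 < (v *m metric a x *m v^T) 0 0;
  metric_change : forall a b x, overlap (man_chart a) (man_chart b) x ->
    let T := transition (man_chart a) (man_chart b) in
    metric a x = 'J T x *m metric b (T x) *m ('J T x)^T
}.

Definition coord (R : realType) (n : nat) (M : smoothManifold R n) (p : M) :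
    'rV[R]_n :=
  chart_map (man_chart (chart_at p)) p.

Definition local_rep (R : realType) (n : nat) (M : smoothManifold R n)
    (T : Type) (f : M -> T) (a : man_index M) : 'rV[R]_n -> T :=
  f \o chart_inv (man_chart a).

(* Meant for open N. *)
Definition Ck_map_on (R : realType) (n : nat) (M : smoothManifold R n)
    (V : normedModType R) (k : nat) (N : set M) (f : M -> V) : Prop :=
  forall a, Ck_on k (chart_map (man_chart a) @` (chart_dom (man_chart a) `&` N))
                  (local_rep f a).

Definition smooth_map (R : realType) (n : nat) (M : smoothManifold R n)
    (V : normedModType R) (f : M -> V) : Prop :=
  forall k, Ck_map_on k [set: M] f.

Section Completeness.
Variables (R : realType) (n : nat) (M : riemannianManifold R n).

(* A C1 curve on [0, 1] extends to a C1 curve on the real line, so it is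
   harmless to parametrize curves by the line. *)
Definition C1_curve (gamma : R -> M) : Prop :=
  continuous gamma /\
  forall (a : man_index M) (t : R), chart_dom (man_chart a) (gamma t) ->
    let c : R -> 'rV[R]_n := chart_map (man_chart a) \o gamma in
    derivable c t 1 /\ {for t, continuous (fun s => 'D_1 c s)}.

Definition speed (gamma : R -> M) (t : R) : R :=
  let a := chart_at (gamma t) in
  let v : 'rV[R]_n := 'D_1 (chart_map (man_chart a) \o gamma) t in
  Num.sqrt ((v *m metric a (coord (gamma t)) *m v^T) 0 0).

Definition curve_length (gamma : R -> M) : \bar R :=
  (\int[@lebesgue_measure R]_(t in `[0%R, 1%R]) (speed gamma t)%:E)%E.

(* p and q are joined by a piecewise C1 curve of length l. *)
Inductive joined (q : M) : M -> \bar R -> Prop :=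
| joined_refl : joined q q 0%E
| joined_step (gamma : R -> M) (l : \bar R) :
    C1_curve gamma -> joined q (gamma 1) l ->
    joined q (gamma 0) (curve_length gamma + l)%E.

Definition riemannian_distance (p q : M) : \bar R :=
  ereal_inf [set l | joined q p l].

Definition complete_manifold : Prop :=
  forall u : nat -> M,
    (forall e : R, 0 < e -> exists N, forall i j, (N <= i)%N -> (N <= j)%N ->
       (riemannian_distance (u i) (u j) < e%:E)%E) ->
    exists p : M, forall e : R, 0 < e -> exists N, forall i, (N <= i)%N ->
       (riemannian_distance (u i) p < e%:E)%E.

End Completeness.

Definition connected_manifold (R : realType) (n : nat)
    (M : smoothManifold R n) : Prop :=
  [set: M] !=set0 /\ connected [set: M].

Section Parabolicity.
Variables (R : realType) (n : nat) (M : riemannianManifold R n).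

Definition laplacian_in (a : man_index M) (f : 'rV[R]_n -> R)
    (x : 'rV[R]_n) : R :=
  let w y : R := Num.sqrt (\det (metric a y)) in
  (w x)^-1 *
  \sum_(i < n) partial i
    (fun y => w y * \sum_(j < n) invmx (metric a y) i j * partial j f y : R) x.

Definition laplacian (f : M -> R) (p : M) : R :=
  laplacian_in (chart_at p) (local_rep f (chart_at p)) (coord p).

(* For merely continuous u, the inequality 0 <= laplacian u is understood in
   the viscosity sense: it is tested on the C2 functions touching u from above.
   For u of class C2 this is the pointwise inequality (take f = u in one
   direction and use the second order condition at a maximum of u - f in the
   other). *)
Definition subharmonic (u : M -> R) : Prop :=
  forall (p : M) (N : set M) (f : M -> R),
    open N -> N p -> Ck_map_on 2 N f ->
    f p = u p -> (forall q, N q -> u q <= f q) ->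
    0 <= laplacian f p.

Definition parabolic : Prop :=
  forall u : M -> R, continuous u -> subharmonic u ->
    (exists C : R, forall p, u p <= C) -> forall p q, u p = u q.

End Parabolicity.

Section Immersions.
Variables (R : realType) (n m : nat) (M : riemannianManifold R n).
Variable X : M -> 'rV[R]_m.

Definition isometric_immersion : Prop :=
  smooth_map X /\
  forall a x, chart_cod (man_chart a) x ->
    let J := 'J (local_rep X a) x in
    row_free J /\ J *m J^T = metric a x.

(* The rows of J span the tangent space, and v *m J^T *m invmx (J *m J^T) *m J
   is the orthogonal projection of v on it. *)
Definition normal_part (p : M) (v : 'rV[R]_m) : 'rV[R]_m :=
  let J := 'J (local_rep X (chart_at p)) (coord p) in
  v - v *m J^T *m invmx (J *m J^T) *m J.

(* Gauss formula: the normal part of the second derivatives of X. *)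
Definition second_fundamental_form (p : M) (i j : 'I_n) : 'rV[R]_m :=
  normal_part p
    (partial i (partial j (local_rep X (chart_at p))) (coord p)).

Definition mean_curvature (p : M) : 'rV[R]_m :=
  \sum_(i < n) \sum_(j < n)
    invmx (metric (chart_at p) (coord p)) i j *: second_fundamental_form p i j.

End Immersions.

Definition self_shrinker (R : realType) (n : nat) (M : riemannianManifold R n)
    (lambda : R) (X : M -> 'rV[R]_n.+1) : Prop :=
  [/\ complete_manifold M, isometric_immersion X, 0 < lambda &
      forall p, mean_curvature X p = - lambda *: normal_part X p (X p)].

(* M is isometric to the subset A of R^m with the metric induced by R^m: there
   is a smooth embedding of image A (an injective immersion which is open onto
   its image) pulling the Euclidean inner product back to the metric of M. *)
Definition isometric_to (R : realType) (n m : nat) (M : riemannianManifold R n)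
    (A : set 'rV[R]_m) : Prop :=
  exists F : M -> 'rV[R]_m,
    [/\ isometric_immersion F,
        injective F,
        (forall U : set M, open U ->
           exists2 V, open V & F @` U = range F `&` V) &
        range F = A].

(* Main.v *)
Require Import Defs.
From mathcomp Require Import all_boot all_order all_algebra.
From mathcomp Require Import all_classical all_reals all_analysis.
From mathcomp Require Import measurable_realfun perm ring lra.

Set Implicit Arguments.
Unset Strict Implicit.
Unset Printing Implicit Defensive.

Import Order.TTheory GRing.Theory Num.Theory.
Import numFieldNormedType.Exports.
Local Open Scope classical_set_scope.
Local Open Scope ring_scope.

(** On the image ball, [u = |X|^2] satisfies [Delta u = 2 (n - lambda |X^N|^2) >= 0],
    [X^N] being the normal part of [X], so parabolicity makes [u] constant; then
    [X] is normal and [u = n / lambda]. Hence [X] is a local isometry into a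
    sphere of its own dimension. By completeness, the two inverse stereographic
    parametrizations of that sphere, which are Lipschitz, lift to [Sigma] along
    rays. Since [n >= 2], the punctured space is connected and the two lifts
    agree where both are defined; their images form a compact open subset of
    [Sigma], hence all of it. So [X] is a bijective local isometry. *)

(** Subharmonicity is tested in the viscosity sense, so the analytic half bounds from below the
    Laplacian of every C2 function touching [|X|^2] from above. The computation rests on
    [Delta X = H], whose content is that [Delta X] has no tangential part. In the second half the
    obstacle is that completeness speaks of the Riemannian distance while lifting speaks of the
    manifold topology. Two local facts link them, without geodesics: nearby points are joined by
    curves of length at most 6 times the distance of their images, and a neighbourhood of a point
    contains a ball for the distance. Lifting is done on domains that are star-shaped about a base
    point, where uniqueness along rays allows lifts to be united. The bound [2 <= n] is essential: a
    circle wrapped several times around the round circle satisfies the other assumptions for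
    [n = 1]. *)

Section EuclideanSpace.
Context {R : realType} {n : nat}.
Implicit Types u v w : 'rV[R]_n.

Lemma dotE u v : dot u v = (u *m v^T) 0 0.
Proof. by rewrite mxE; apply: eq_bigr => i _; rewrite mxE. Qed.

Lemma dotC u v : dot u v = dot v u.
Proof. by apply: eq_bigr => i _; rewrite mulrC. Qed.

Lemma dotDl u v w : dot (u + v) w = dot u w + dot v w.
Proof. by rewrite !dotE mulmxDl mxE. Qed.

Lemma dotNl u w : dot (- u) w = - dot u w.
Proof. by rewrite !dotE mulNmx mxE. Qed.

Lemma dotZl a u w : dot (a *: u) w = a * dot u w.
Proof. by rewrite !dotE -scalemxAl mxE. Qed.

Lemma dotDr u v w : dot w (u + v) = dot w u + dot w v.
Proof. by rewrite ![dot w _]dotC dotDl. Qed.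

Lemma dotNr u w : dot w (- u) = - dot w u.
Proof. by rewrite ![dot w _]dotC dotNl. Qed.

Lemma dotZr a u w : dot w (a *: u) = a * dot w u.
Proof. by rewrite ![dot w _]dotC dotZl. Qed.

Lemma dot0l w : dot 0 w = 0.
Proof. by rewrite !dotE mul0mx mxE. Qed.

Lemma dot_suml I (r : seq I) (P : pred I) (F : I -> 'rV[R]_n) w :
  dot (\sum_(i <- r | P i) F i) w = \sum_(i <- r | P i) dot (F i) w.
Proof. by rewrite (big_morph (fun u => dot u w) (id1 := 0) (op1 := +%R)) ?dot0l//; move=> ? ?;
  rewrite dotDl. Qed.

Lemma dot_ge0 u : 0 <= dot u u.
Proof. by apply: sumr_ge0 => i _; rewrite -expr2 sqr_ge0. Qed.

Lemma dot_eq0 u : (dot u u == 0) = (u == 0).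
Proof.
apply/idP/eqP => [|->]; last by rewrite dot0l.
rewrite psumr_eq0 => [|i _]; last by rewrite -expr2 sqr_ge0.
move=> /allP h; apply/rowP => i; rewrite mxE.
by have /(_ (mem_index_enum i)) := h i; rewrite -expr2 sqrf_eq0 => /eqP.
Qed.

Lemma enorm_ge0 u : 0 <= enorm u.
Proof. exact: sqrtr_ge0. Qed.

Lemma sqr_enorm u : enorm u ^+ 2 = dot u u.
Proof. by rewrite sqr_sqrtr ?dot_ge0. Qed.

Lemma enorm0 : enorm (0 : 'rV[R]_n) = 0.
Proof. by rewrite /enorm dot0l sqrtr0. Qed.

Lemma enorm_eq0 u : (enorm u == 0) = (u == 0).
Proof. by rewrite -dot_eq0 -sqr_enorm sqrf_eq0. Qed.

Lemma enormZ a u : enorm (a *: u) = `|a| * enorm u.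
Proof.
by rewrite /enorm dotZl dotZr mulrA -expr2 sqrtrM ?sqr_ge0// sqrtr_sqr.
Qed.

Lemma enormN u : enorm (- u) = enorm u.
Proof. by rewrite /enorm dotNl dotNr opprK. Qed.

Lemma enormB u v : enorm (u - v) = enorm (v - u).
Proof. by rewrite -enormN opprB. Qed.

(** The square of [|v| u - |u| v] expands to [2 |u| |v| (|u| |v| - <u, v>)]. *)
Lemma cauchy_schwarz u v : dot u v <= enorm u * enorm v.
Proof.
have [->|u0] := eqVneq u 0; first by rewrite dot0l enorm0 mul0r.
have [->|v0] := eqVneq v 0; first by rewrite dotC dot0l enorm0 mulr0.
have eu : 0 < enorm u by rewrite lt_def enorm_eq0 u0 enorm_ge0.
have ev : 0 < enorm v by rewrite lt_def enorm_eq0 v0 enorm_ge0.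
have := dot_ge0 (enorm v *: u - enorm u *: v).
rewrite !(dotDl, dotDr, dotNl, dotNr, dotZl, dotZr) -!sqr_enorm (dotC v u).
set a := enorm u; set b := enorm v; set d := dot u v => h.
have : 0 <= (a * b) * (a * b - d) by lra.
by rewrite pmulr_rge0 ?subr_ge0// mulr_gt0.
Qed.

Lemma enormD u v : enorm (u + v) <= enorm u + enorm v.
Proof.
rewrite -(@ler_pXn2r _ 2) ?nnegrE ?addr_ge0 ?enorm_ge0//.
rewrite sqr_enorm !(dotDl, dotDr) -!sqr_enorm (dotC v u).
by have := cauchy_schwarz u v; lra.
Qed.

Lemma coord_le_norm u i : `|u 0 i| <= `|u|.
Proof.
by rewrite [leRHS]/Num.Def.normr/= mx_normrE; exact: (le_bigmax _ _ (0, i)).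
Qed.

Lemma norm_le_enorm u : `|u| <= enorm u.
Proof.
rewrite [leLHS]/Num.Def.normr/= mx_normrE bigmax_le ?enorm_ge0// => -[i j] _ /=.
rewrite (ord1 i) -sqrtr_sqr ler_wsqrtr// /dot (bigD1 j)//= -expr2 lerDl.
by apply: sumr_ge0 => k _; rewrite -expr2 sqr_ge0.
Qed.

(** The sharp constant is the square root of [n]; the cruder [n] is enough to pass from the sup norm
    of the topology to the Euclidean norm. *)
Lemma enorm_le_norm u : enorm u <= n%:R * `|u|.
Proof.
rewrite -(@ler_pXn2r _ 2) ?nnegrE ?mulr_ge0 ?enorm_ge0//.
rewrite sqr_enorm exprMn.
apply: (@le_trans _ _ (\sum_(i < n) `|u| ^+ 2)).
  by apply: ler_sum => i _; rewrite -expr2 -real_normK ?num_real// ler_pXn2r ?nnegrE ?coord_le_norm.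
rewrite sumr_const card_ord -[leLHS]mulr_natl ler_wpM2r ?sqr_ge0//.
by rewrite -natrX ler_nat; case: n => // k; exact: leq_pmulr.
Qed.

End EuclideanSpace.

(** * Calculus along lines: mean values, symmetry of second derivatives, minima *)

Section Calculus.
Context {R : realType} {n : nat}.

Lemma derive_partial (V : normedModType R) (f : 'rV[R]_n -> V) x v :
  differentiable f x -> 'D_v f x = \sum_i v 0 i *: partial i f x.
Proof.
move=> df; rewrite deriveE// {1}(row_sum_delta v) linear_sum; apply: eq_bigr => i _.
by rewrite linearZ /= /partial deriveE.
Qed.

Lemma row_jacobian m (f : 'rV[R]_n -> 'rV[R]_m) x i :
  differentiable f x -> row i ('J f x) = partial i f x.
Proof. by move=> df; rewrite rowE /partial deriveEjacobian. Qed.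

Lemma is_derive_line (V : normedModType R) (f : 'rV[R]_n -> V) x v (s : R) :
  differentiable f (x + s *: v) ->
  is_derive s 1 (fun t => f (x + t *: v)) ('D_v f (x + s *: v)).
Proof.
move=> df.
have dl : is_diff s (fun t : R => x + t *: v) (fun t => t *: v).
  have := @is_diffD R R 'rV[R]_n (cst x) ( *:%R^~ v) _ _ s (is_diff_cst x s) (is_diff_scalel s v).
  by rewrite add0r.
have dc : differentiable (f \o (fun t : R => x + t *: v)) s.
  by apply: differentiable_comp => //.
apply: DeriveDef; first exact/derivable1_diffP.
rewrite deriveE// (@diff_comp _ _ _ _ (fun t : R => x + t *: v) f)//=.
by rewrite diff_val /= scale1r deriveE.
Qed.

End Calculus.

Section SegmentCalculus.
Context {R : realType} {n : nat}.
Implicit Types (f : 'rV[R]_n -> R) (x v : 'rV[R]_n).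

Lemma line_mean_value f x v (s : R) : 0 < s ->
  (forall t, 0 <= t <= s -> differentiable f (x + t *: v)) ->
  exists2 t, 0 < t < s & f (x + s *: v) - f x = s * 'D_v f (x + t *: v).
Proof.
move=> s0 df.
have [] := @MVT R (fun t => f (x + t *: v)) (fun t => 'D_v f (x + t *: v)) 0 s s0.
- move=> t; rewrite in_itv/= => /andP[t0 ts].
  by apply: is_derive_line; apply: df; rewrite !ltW.
- apply: derivable_within_continuous => t; rewrite in_itv/= => ts.
  exact: (@ex_derive _ _ _ _ _ _ _ (is_derive_line (df _ ts))).
move=> t; rewrite in_itv/= => ts; rewrite scale0r addr0 subr0 mulrC => ->.
by exists t.
Qed.

Lemma mean_value_segment f x y :
  (forall t, 0 <= t <= 1 -> differentiable f (x + t *: (y - x))) ->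
  exists2 t, 0 < t < 1 & f y - f x = 'D_(y - x) f (x + t *: (y - x)).
Proof.
move=> df; have [t t01] := @line_mean_value f x (y - x) 1 ltr01 df.
by rewrite scale1r mul1r subrKC => ->; exists t.
Qed.

Let subrACA (p q r t : R) : p - q - (r - t) = p - r - (q - t).
Proof. by ring. Qed.

(** Mean value theorem twice: for [y |-> f (y + s u) - f y] along [v], then for ['D_v f] along [u].
    The left side is symmetric in [u] and [v], and this symmetry passes to the second
    derivatives. *)
Lemma mixed_difference f x u v (U : set 'rV[R]_n) (s : R) : 0 < s ->
  (forall y, U y -> differentiable f y) ->
  (forall y, U y -> differentiable ('D_v f) y) ->
  (forall a b, 0 <= a <= s -> 0 <= b <= s -> U (x + a *: u + b *: v)) ->
  exists2 ab, (0 <= ab.1 <= s) && (0 <= ab.2 <= s) &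
    (f (x + s *: u + s *: v) - f (x + s *: u)) - (f (x + s *: v) - f x) =
    s * s * 'D_u ('D_v f) (x + ab.1 *: u + ab.2 *: v).
Proof.
move=> s0 df ddf hU.
have s00 : 0 <= s <= s by rewrite lexx ltW.
pose g (y : 'rV[R]_n) := f (y + s *: u) - f y.
have dsh y : U (y + s *: u) -> is_diff y (fun z => f (z + s *: u)) ('d f (y + s *: u)).
  move=> Uy; have := df _ Uy => dfy.
  have h1 : is_diff y (fun z => z + s *: u) id.
    have := @is_diffD R _ _ id (cst (s *: u)) _ _ y (is_diff_id y) (is_diff_cst _ y).
    by rewrite addr0.
  have := @is_diff_comp R _ _ _ _ _ f _ y h1 (differentiableP dfy).
  by [].
have dg t : 0 <= t <= s -> differentiable g (x + t *: v) /\
    'D_v g (x + t *: v) = 'D_v f (x + t *: v + s *: u) - 'D_v f (x + t *: v).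
  move=> ts.
  have U0 : U (x + t *: v) by have := hU 0 t; rewrite scale0r addr0 lexx ltW//; apply.
  have U1 : U (x + t *: v + s *: u).
    by have := hU s t; rewrite s00 addrAC; apply.
  have h1 := dsh _ U1.
  have h2 := differentiableP (df _ U0).
  have h3 := is_diffB h1 h2.
  have h4 : differentiable g (x + t *: v) by case: h3.
  split=> //.
  rewrite deriveE//; case: h3 => _; rewrite /g => ->; rewrite !deriveE//; exact: df.
have [b b01] := @line_mean_value g x v s s0 (fun t ts => (dg t ts).1).
have bs : 0 <= b <= s by case/andP: b01 => *; rewrite !ltW.
rewrite (dg b bs).2 => e1.
have dd a : 0 <= a <= s -> differentiable ('D_v f) (x + b *: v + a *: u).
  by move=> as_; apply: ddf; rewrite addrAC; apply: hU.
have [a a01 e2] := @line_mean_value ('D_v f) (x + b *: v) u s s0 dd.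
exists (a, b); first by case/andP: a01 => *; rewrite /= bs !ltW.
rewrite /= -mulrA [x + a *: u + _]addrAC -e2 -e1 /g.
by rewrite [x + s *: v + _]addrAC; exact: subrACA.
Qed.

(** The second difference is [s * s] times either mixed derivative at some point of a small
    parallelogram; continuity at [x] compares both values with those at [x]. *)
Lemma derive_sym f x u v (U : set 'rV[R]_n) : nbhs x U ->
  (forall y, U y -> differentiable f y) ->
  (forall y, U y -> differentiable ('D_u f) y) ->
  (forall y, U y -> differentiable ('D_v f) y) ->
  {for x, continuous ('D_u ('D_v f))} -> {for x, continuous ('D_v ('D_u f))} ->
  'D_u ('D_v f) x = 'D_v ('D_u f) x.
Proof.
move=> nU df du dv cuv cvu.
apply/eqP; rewrite -subr_eq0 -normr_le0; apply/ler_addgt0Pl => e e0; rewrite addr0.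
have e20 : 0 < e / 2 by rewrite divr_gt0.
have tri (A B C : R) : `|A - C| < e / 2 -> `|C - B| < e / 2 -> `|A - B| <= e.
  by move=> h1 h2; rewrite (le_trans (ler_distD C _ _))// [leRHS]splitr lerD// ltW.
have n1 : \forall y \near x, [/\ U y, `|'D_u ('D_v f) x - 'D_u ('D_v f) y| < e / 2
    & `|'D_v ('D_u f) x - 'D_v ('D_u f) y| < e / 2].
  have h1 : \forall y \near x, `|'D_u ('D_v f) x - 'D_u ('D_v f) y| < e / 2.
    by have /cvgrPdist_lt := cuv; apply.
  have h2 : \forall y \near x, `|'D_v ('D_u f) x - 'D_v ('D_u f) y| < e / 2.
    by have /cvgrPdist_lt := cvu; apply.
  by move: nU h1 h2; apply: filterS3 => y; split.
have [d /= d0 hd] := (nbhs_normP _ _).1 n1.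
(* The summand 1 keeps [M] positive for [u = v = 0]; as [s * M = d / 2], the parallelogram of side
   [s] stays in the [d]-ball. *)
pose M := `|u| + `|v| + 1.
have M0 : 0 < M by rewrite /M ltr_wpDl// addr_ge0.
pose s := d / 2 / M.
have s0 : 0 < s by rewrite !divr_gt0.
have hball a b : 0 <= a <= s -> 0 <= b <= s -> ball_ Num.Def.normr x d (x + a *: u + b *: v).
  move=> /andP[a0 as_] /andP[b0 bs].
  rewrite /ball_ /= -addrA opprD addrA subrr sub0r normrN.
  apply: (le_lt_trans (ler_normD _ _)); rewrite !normrZ !ger0_norm//.
  apply: (@le_lt_trans _ _ (s * `|u| + s * `|v|)); first by rewrite lerD// ler_wpM2r.
  rewrite -mulrDr; apply: (@lt_trans _ _ (s * M)); first by rewrite ltr_pM2l// /M ltrDl.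
  by rewrite divfK ?gt_eqF// ltr_pdivrMr// ltr_pMr// ltr1n.
have h a b : 0 <= a <= s -> 0 <= b <= s -> [/\ U (x + a *: u + b *: v),
  `|'D_u ('D_v f) x - 'D_u ('D_v f) (x + a *: u + b *: v)| < e / 2
    & `|'D_v ('D_u f) x - 'D_v ('D_u f) (x + a *: u + b *: v)| < e / 2].
  by move=> ha hb; exact: hd (hball _ _ ha hb).
have [[a b] /= /andP[ha hb] e1] := @mixed_difference f x u v U s s0 df dv
  (fun a b ha hb => let: And3 h _ _ := h a b ha hb in h).
have hU' a' b' : 0 <= a' <= s -> 0 <= b' <= s -> U (x + a' *: v + b' *: u).
  by move=> ha' hb'; rewrite addrAC; have [] := h b' a' hb' ha'.
have [[a' b'] /= /andP[ha' hb'] e2] := @mixed_difference f x v u U s s0 df du hU'.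
have [_ h1 _] := h a b ha hb.
have [_ _ h2] := h b' a' hb' ha'.
move: e2; rewrite [x + s *: v + _]addrAC [x + a' *: v + _]addrAC => e2.
have e3 : 'D_u ('D_v f) (x + a *: u + b *: v) = 'D_v ('D_u f) (x + b' *: u + a' *: v).
  have /mulfI ss0 : s * s != 0 by rewrite mulf_neq0// gt_eqF.
  by move: e1; rewrite subrACA e2 => /ss0 ->.
rewrite -e3 in h2.
rewrite distrC in h2.
exact: tri h1 h2.
Qed.

Lemma near_line x v (U : set 'rV[R]_n) : nbhs x U ->
  exists2 s : R, 0 < s & forall t, `|t| <= s -> U (x + t *: v).
Proof.
move=> nU.
have [d /= d0 hd] := (nbhs_normP _ _).1 nU.
pose s := d / 2 / (`|v| + 1).
have v1 : 0 < `|v| + 1 by rewrite ltr_wpDl.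
have s0 : 0 < s by rewrite !divr_gt0.
exists s => // t ts; apply: hd; rewrite /ball_ /= opprD addrA subrr sub0r normrN normrZ.
apply: (@le_lt_trans _ _ (s * `|v|)); first by rewrite ler_wpM2r.
apply: (@lt_trans _ _ (s * (`|v| + 1))); first by rewrite ltr_pM2l// ltrDl.
by rewrite divfK ?gt_eqF// ltr_pdivrMr// ltr_pMr// ltr1n.
Qed.

Lemma derive_at_min f x v (U : set 'rV[R]_n) : nbhs x U ->
  (forall y, U y -> differentiable f y) ->
  (forall y, U y -> f x <= f y) -> 'D_v f x = 0.
Proof.
move=> nU df hmin; have [s s0 hU] := near_line v nU.
have h0 : is_derive (0 : R) 1 (fun t => f (x + t *: v)) ('D_v f (x + 0 *: v)).
  by apply: is_derive_line; apply: df; apply: hU; rewrite normr0 ltW.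
have h1 : is_derive (0 : R) 1 (fun t => f (x + t *: v)) 0.
  apply: (@derive1_at_min _ _ (- s) s).
  - by rewrite ge0_cp// ltW.
  - move=> t; rewrite in_itv/= => /andP[t1 t2].
    apply: (@ex_derive _ _ _ _ _ _ _ (is_derive_line _)); apply: df; apply: hU.
    by rewrite ler_norml !ltW.
  - by rewrite in_itv/= oppr_lt0 s0.
  - move=> t; rewrite in_itv/= => /andP[t1 t2].
    by rewrite scale0r addr0; apply: hmin; apply: hU; rewrite ler_norml !ltW.
move: (@derive_val _ _ _ _ _ _ _ h0); rewrite (@derive_val _ _ _ _ _ _ _ h1).
by rewrite scale0r addr0.
Qed.

(** A negative second derivative would make ['D_v f], which vanishes at [x], negative just beyond
    it, and the mean value theorem would give a value below [f x]. *)
Lemma second_derivative_at_min f x v (U : set 'rV[R]_n) : nbhs x U ->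
  (forall y, U y -> differentiable f y) ->
  derivable ('D_v f) x v ->
  (forall y, U y -> f x <= f y) ->
  'D_v f x = 0 /\ 0 <= 'D_v ('D_v f) x.
Proof.
move=> nU df ddf hmin.
have [s s0 hU] := near_line v nU.
have e1 := derive_at_min v nU df hmin.
split=> //; rewrite leNgt; apply/negP => neg.
have /cvgr_lt /(_ 0 neg) : (fun h : R => h^-1 *: ('D_v f (h *: v + x) - 'D_v f x)) @ 0^' -->
    'D_v ('D_v f) x by exact: ddf.
move=> /nbhs_normP [r /= r0 hr].
pose q := Num.min s r / 2.
have m0 : 0 < Num.min s r by rewrite lt_min s0.
have q0 : 0 < q by rewrite divr_gt0.
have qm : q < Num.min s r by rewrite ltr_pdivrMr// ltr_pMr// ltr1n.
move: qm; rewrite lt_min => /andP[qs qr].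
have [t|t /andP[t0 tq] e2] := @line_mean_value f x v q q0.
  by move=> /andP[t0 tq]; apply: df; apply: hU; rewrite ger0_norm// (le_trans tq)// ltW.
have Uq : U (x + q *: v) by apply: hU; rewrite gtr0_norm// ltW.
have := hmin _ Uq; rewrite -subr_ge0 e2 pmulr_rge0// leNgt => /negP; apply.
have := hr t; rewrite /ball_ /= sub0r normrN gtr0_norm// (lt_trans tq qr) => /(_ isT).
move=> /(_ (lt0r_neq0 t0)); rewrite e1 subr0 addrC.
by rewrite /GRing.scale /= pmulr_rlt0// invr_gt0.
Qed.

End SegmentCalculus.

(** * Product rules, derivatives of determinants and inverses, Hessians *)

Section ProductRules.
Context {R : realType} {V : normedModType R}.
Implicit Types (x v : V).

Lemma is_derive_sumf n (h : 'I_n -> V -> R) (dh : 'I_n -> R) x v :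
  (forall i, is_derive x v (h i) (dh i)) ->
  is_derive x v (fun y => \sum_i h i y) (\sum_i dh i).
Proof.
move=> hd; have := @is_derive_sum _ _ _ n h x v dh hd.
by congr is_derive; apply/funext => y; rewrite fct_sumE.
Qed.

Lemma differentiable_sumf n (h : 'I_n -> V -> R) x :
  (forall i, differentiable (h i) x) ->
  differentiable (fun y => \sum_i h i y) x.
Proof.
move=> hd; have := @differentiable_sum _ _ _ n h x hd.
rewrite (_ : \sum_(i < n) h i = fun y => \sum_i h i y)//.
by apply/funext => y; rewrite fct_sumE.
Qed.

Lemma is_derive_mxP m n (f : V -> 'M[R]_(m, n)) (df : 'M[R]_(m, n)) x v :
  is_derive x v f df <-> forall i j, is_derive x v (fun y => f y i j) (df i j).
Proof.
split=> [[h1 h2] i j|h].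
  apply: DeriveDef; first by have /derivable_mxP := h1; apply.
  by rewrite -h2 derive_mx// mxE.
have h1 : derivable f x v by apply/derivable_mxP => i j; case: (h i j).
apply: DeriveDef => //; rewrite derive_mx//; apply/matrixP => i j.
by rewrite mxE; case: (h i j).
Qed.

Lemma differentiable_entry m n (f : V -> 'M[R]_(m, n)) x i j :
  differentiable f x -> differentiable (fun y => f y i j) x.
Proof.
move=> df; have := @differentiable_comp _ _ _ _ f (fun N => N i j : R) x df.
by apply; exact: differentiable_coord.
Qed.

Lemma is_derive_dot m (f g : V -> 'rV[R]_m) df dg x v :
  is_derive x v f df -> is_derive x v g dg ->
  is_derive x v (fun y => dot (f y) (g y)) (dot df (g x) + dot (f x) dg).
Proof.
move=> /is_derive_mxP hf /is_derive_mxP hg.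
rewrite /dot -big_split /=; apply: is_derive_sumf => i.
have := @is_deriveM _ _ _ _ _ _ _ _ (hf 0 i) (hg 0 i).
by rewrite /GRing.scale /= addrC [g x 0 i * _]mulrC.
Qed.

Lemma differentiable_dot m (f g : V -> 'rV[R]_m) x :
  differentiable f x -> differentiable g x ->
  differentiable (fun y => dot (f y) (g y)) x.
Proof.
move=> df dg; apply: differentiable_sumf => i.
by apply: differentiableM; exact: differentiable_entry.
Qed.

Lemma is_derive_prodf n (h : 'I_n -> V -> R) (dh : 'I_n -> R) x v :
  (forall i, is_derive x v (h i) (dh i)) ->
  is_derive x v (fun y => \prod_i h i y)
    (\sum_i \prod_j (if j == i then dh j else h j x)).
Proof.
elim: n h dh => [|n IH] h dh hd.
  rewrite big_ord0; have := is_derive_cst (1 : R) x v.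
  by congr is_derive; apply/funext => y; rewrite big_ord0.
have := @is_deriveM _ _ _ _ _ _ _ _ (hd ord0)
  (IH (fun i => h (lift ord0 i)) (fun i => dh (lift ord0 i)) (fun i => hd _)).
rewrite big_ord_recl big_ord_recl eqxx addrC.
have -> : \prod_(i < n) (if lift ord0 i == ord0 then dh (lift ord0 i)
    else h (lift ord0 i) x) = \prod_(i < n) h (lift ord0 i) x by apply: eq_bigr.
have -> : \sum_(i < n) \prod_j (if j == lift ord0 i then dh j else h j x) =
    h ord0 x * \sum_(i < n) \prod_j (if j == i then dh (lift ord0 j) else h (lift ord0 j) x).
  rewrite mulr_sumr; apply: eq_bigr => i _; rewrite big_ord_recl; congr (_ * _).
congr is_derive; first by apply/funext => y; rewrite big_ord_recl.
by rewrite /GRing.scale /= [_ * dh ord0]mulrC.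
Qed.

Lemma differentiable_prodf n (h : 'I_n -> V -> R) x :
  (forall i, differentiable (h i) x) ->
  differentiable (fun y => \prod_i h i y) x.
Proof.
elim: n h => [|n IH] h hd.
  rewrite (_ : (fun y => _) = cst (1 : R)); first exact: differentiable_cst.
  by apply/funext => y; rewrite big_ord0.
have := differentiableM (hd ord0) (IH (fun i => h (lift ord0 i)) (fun i => hd _)).
rewrite (_ : (fun y => \prod_i h i y) = h ord0 * fun y => \prod_i h (lift ord0 i) y)//.
by apply/funext => y; rewrite big_ord_recl.
Qed.

Lemma differentiable_det n (M : V -> 'M[R]_n) x :
  (forall i j, differentiable (fun y => M y i j) x) ->
  differentiable (fun y => \det (M y)) x.
Proof.
move=> hM; rewrite (_ : (fun y => \det (M y)) =
    \sum_(s : 'S_n) ((-1) ^+ s *: (fun y => \prod_i M y i (s i)))); last first.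
  by apply/funext => y; rewrite fct_sumE.
elim/big_ind : _ => [|f g|s _]; first exact: differentiable_cst.
  exact: differentiableD.
by apply: differentiableZ; apply: differentiable_prodf => i.
Qed.

(** Jacobi's formula: differentiate the Leibniz expansion one row at a time, then expand each
    determinant along the differentiated row, which its cofactors do not see. *)
Lemma is_derive_det n (M : V -> 'M[R]_n) dM x v :
  is_derive x v M dM ->
  is_derive x v (fun y => \det (M y)) (\tr (dM *m \adj (M x))).
Proof.
move=> /is_derive_mxP hM.
have hs (s : 'S_n) := @is_derive_prodf n (fun i y => M y i (s i)) (fun i => dM i (s i)) x v
  (fun i => hM i (s i)).
have h1 : is_derive x v (fun y => \det (M y)) (\sum_(s : 'S_n) (-1) ^+ s *
    (\sum_i \prod_j (if j == i then dM j (s j) else M x j (s j)))).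
  rewrite (_ : (fun y => \det (M y)) =
    \sum_(s : 'S_n) ((-1) ^+ s *: (fun y => \prod_i M y i (s i)))); last first.
    by apply/funext => y; rewrite fct_sumE.
  elim/big_ind2 : _ => [|f df g dg|s _]; first exact: is_derive_cst.
    exact: is_deriveD.
  exact: is_deriveZ.
move: h1; congr is_derive.
pose A i := \matrix_(j, k) (if j == i then dM j k else M x j k).
transitivity (\sum_i \det (A i)).
  under eq_bigr do rewrite mulr_sumr.
  rewrite exchange_big/=; apply: eq_bigr => i _; apply: eq_bigr => s _; congr (_ * _).
  by apply: eq_bigr => j _; rewrite mxE.
apply: eq_bigr => i _; rewrite (expand_det_row _ i) mxE; apply: eq_bigr => k _.
rewrite !mxE eqxx; congr (_ * _); rewrite /cofactor; congr (_ * \det _).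
by apply/matrixP => a b; rewrite !mxE; have := neq_lift i a; rewrite eq_sym => /negPf ->.
Qed.

Lemma adj_unitmx n (A : 'M[R]_n) : A \in unitmx -> \adj A = \det A *: invmx A.
Proof.
by move=> uA; rewrite /invmx uA scalerA mulfV ?scale1r// -unitfE -unitmxE.
Qed.

(** By Cramer's rule the entry is a signed minor, to which [is_derive_det] applies, over the
    determinant. Invertibility is asked near [x] because this formula fails for [invmx] on singular
    matrices. *)
Lemma derivable_invmx n (M : V -> 'M[R]_n) x v i j :
  derivable M x v -> (\forall y \near x, M y \in unitmx) ->
  derivable (fun y => invmx (M y) i j) x v.
Proof.
move=> dM uM.
apply: (@near_eq_derivable _ _ _ (fun y => (\det (M y))^-1 * cofactor (M y) j i)).
  by apply: filterS uM => y uM; rewrite /invmx uM !mxE.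
apply: derivableM.
  apply: derivableV; last first.
    by have := is_derive_det (derivableP dM) => -[].
  by have := nbhs_singleton uM; rewrite unitmxE unitfE.
apply: derivableM; first exact: derivable_cst.
suff /derivableP/is_derive_det[] : derivable (fun y => row' j (col' i (M y))) x v by [].
apply/derivable_mxP => a b; rewrite (_ : (fun y => _) = fun y => M y (lift j a) (lift i b)).
  by move/derivable_mxP : dM.
by apply/funext => y; rewrite !mxE.
Qed.

End ProductRules.

#[local] Opaque derive.

Section NearEquality.
Context {R : realType}.

(** Coordinate formulas hold only on an open set; the first-order expansion carries
    differentiability through an identity valid near [x]. *)
Lemma near_eq_differentiable (V W : normedModType R) (f g : V -> W) x :
  (\forall y \near x, f y = g y) -> differentiable f x -> differentiable g x.
Proof.
move=> fg df.
have e : g \o shift x = cst (g x) + 'd f x +o_ 0 id.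
  apply/eqaddoP => _/posnumP[eps].
  have /diff_locally/eqaddoP/(_ _ (gt0 eps)) h1 := df.
  have h2 : \forall h \near (0 : V), f (h + x) = g (h + x).
    have c : (fun h => h + x) @ (0 : V) --> x.
      by rewrite -[X in _ --> X]add0r; apply: cvgD; [exact: cvg_id|exact: cvg_cst].
    exact: c fg.
  move: h1 h2; apply: filterS2 => h h1 e.
  change (`|g (h + x) - (g x + 'd f x h)| <= eps%:num * `|h|).
  by rewrite -e -(nbhs_singleton fg); exact: h1.
have dc : continuous ('d f x) by exact: diff_continuous.
have de : 'd g x = 'd f x :> (V -> W) by exact: diff_unique.
by apply/diff_locallyP; rewrite de.
Qed.

#[local] Transparent derive.
(** This reduction to one variable makes the one-variable chain rule available for the square
    root. *)
Lemma is_derive_lineP (V W : normedModType R) (f : V -> W) x v df :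
  is_derive x v f df <-> is_derive (0 : R) 1 (fun t => f (t *: v + x)) df.
Proof.
have e : 'D_v f x = 'D_1 (fun t : R => f (t *: v + x)) 0.
  rewrite /derive; set A := fun h => _; set B := fun h => _.
  suff -> : A = B by []; apply/funext => h; rewrite /A /B /=.
  by rewrite addr0 scale0r add0r [_%:A]mulr1.
split=> -[h1 h2]; apply: DeriveDef.
- by move/derivable1P : h1.
- by rewrite -e.
- by apply/derivable1P.
- by rewrite e.
Qed.

#[local] Opaque derive.

Lemma is_derive_sqrt (V : normedModType R) (h : V -> R) dh x v : 0 < h x ->
  is_derive x v h dh ->
  is_derive x v (fun y => Num.sqrt (h y)) ((2 * Num.sqrt (h x))^-1 * dh).
Proof.
move=> h0 /is_derive_lineP hd; apply/is_derive_lineP.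
have h1 : is_derive (h (0 *: v + x)) 1 Num.sqrt (2 * Num.sqrt (h x))^-1.
  by rewrite scale0r add0r; exact: is_derive1_sqrt.
exact: (@is_derive1_comp _ Num.sqrt (fun t => h (t *: v + x)) _ _ _ h1 hd).
Qed.

End NearEquality.

Section SecondOrder.
Context {R : realType} {n : nat}.

Lemma derive_derive_partial (F : 'rV[R]_n -> R) x v (U : set 'rV[R]_n) :
  nbhs x U -> (forall y, U y -> differentiable F y) ->
  (forall j, differentiable (partial j F) x) ->
  is_derive x v ('D_v F)
    (\sum_i \sum_j v 0 i * v 0 j * partial i (partial j F) x).
Proof.
move=> nU dF ddF.
apply: (@near_eq_is_derive _ _ _ (fun y => \sum_j v 0 j * partial j F y)).
  by apply: filterS nU => y Uy; rewrite derive_partial//; exact: dF.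
rewrite exchange_big /=; apply: is_derive_sumf => j.
have := @is_deriveZ _ _ _ (partial j F) (v 0 j) x v _ (derivableP (@diff_derivable _ _ _ _ _ v
  (ddF j))).
congr is_derive; rewrite derive_partial// scaler_sumr; apply: eq_bigr => i _.
by rewrite /GRing.scale /= mulrCA mulrA.
Qed.

(** The quadratic form is ['D_v ('D_v F) x], so the test along each line gives both claims. *)
Lemma hessian_at_min (F : 'rV[R]_n -> R) x (U : set 'rV[R]_n) :
  nbhs x U -> (forall y, U y -> differentiable F y) ->
  (forall j, differentiable (partial j F) x) ->
  (forall y, U y -> F x <= F y) ->
  (forall j, partial j F x = 0) /\
  forall v : 'rV_n, 0 <= \sum_i \sum_j v 0 i * v 0 j * partial i (partial j F) x.
Proof.
move=> nU dF ddF hmin.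
have h v := derive_derive_partial v nU dF ddF.
split=> [j|v].
  by have [] := second_derivative_at_min nU dF (@ex_derive _ _ _ _ _ _ _ (h (delta_mx 0 j))) hmin.
have [_] := second_derivative_at_min nU dF (@ex_derive _ _ _ _ _ _ _ (h v)) hmin.
by rewrite (@derive_val _ _ _ _ _ _ _ (h v)).
Qed.

Definition C2_on (V : normedModType R) (U : set 'rV[R]_n) (f : 'rV[R]_n -> V) :=
  [/\ forall x, U x -> differentiable f x,
      forall j x, U x -> differentiable (partial j f) x &
      forall i j x, U x -> {for x, continuous (partial i (partial j f))}].

Lemma Ck_on_C2 (V : normedModType R) (U : set 'rV[R]_n) (f : 'rV[R]_n -> V) :
  Ck_on 2 U f -> C2_on U f.
Proof.
by move=> [h1 h2]; split=> // [j|i j]; case: (h2 j) => // + /(_ i).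
Qed.

Lemma partial_sym m (f : 'rV[R]_n -> 'rV[R]_m) (U : set 'rV[R]_n) i j x :
  open U -> C2_on U f -> U x ->
  partial i (partial j f) x = partial j (partial i f) x.
Proof.
move=> oU [h1 h2 h3] Ux; apply/rowP => k.
have e1 l y : U y -> partial l f y 0 k = partial l (fun z => f z 0 k) y.
  by move=> Uy; rewrite /partial derive_mx ?mxE//; exact: diff_derivable (h1 _ Uy).
have e2 l l' y : U y -> partial l' (partial l f) y 0 k =
    partial l' (partial l (fun z => f z 0 k)) y.
  move=> Uy; rewrite {1}/partial derive_mx ?mxE; last exact: diff_derivable (h2 _ _ Uy).
  apply: near_eq_derive.
  by apply: filterS (open_nbhs_nbhs (conj oU Uy)) => z Uz; exact: e1.
have d1 y : U y -> differentiable (fun z => f z 0 k) y.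
  by move=> Uy; apply: differentiable_entry; exact: h1.
have d2 l y : U y -> differentiable (partial l (fun z => f z 0 k)) y.
  move=> Uy; apply: (@near_eq_differentiable _ _ _ (fun z => partial l f z 0 k)).
    by apply: filterS (open_nbhs_nbhs (conj oU Uy)) => z Uz; exact: e1.
  by apply: differentiable_entry; exact: h2.
have d3 l l' : {for x, continuous (partial l (partial l' (fun z => f z 0 k)))}.
  rewrite /prop_for /continuous_at -e2//.
  apply: (@cvg_trans _ ((fun z => partial l (partial l' f) z 0 k) @ x)).
    apply: (near_eq_cvg (F := nbhs x)).
    by apply: filterS (open_nbhs_nbhs (conj oU Ux)) => z Uz; exact: e2.
  exact: (@continuous_comp _ _ _ (partial l (partial l' f)) (fun N : 'rV_m => N 0 k)
    x (h3 _ _ _ Ux) (@coord_continuous _ _ _ 0 k _)).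
have sym := @derive_sym _ _ _ x _ _ U (open_nbhs_nbhs (conj oU Ux)) d1 (d2 i) (d2 j) (d3 _ _) (d3
  _ _).
exact: etrans (e2 j i x Ux) (etrans sym (esym (e2 i j x Ux))).
Qed.

End SecondOrder.

(** * The Laplacian of the squared norm *)

Section CoordinateLaplacian.
Context {R : realType} {n m : nat}.
Variables (U : set 'rV[R]_n) (f : 'rV[R]_n -> 'rV[R]_m) (G : 'rV[R]_n -> 'M[R]_n).
Hypothesis oU : open U.
Hypothesis f2 : C2_on U f.
Hypothesis GE : forall y, U y -> forall i j, G y i j = dot (partial i f y) (partial j f y).
Hypothesis detG : forall y, U y -> 0 < \det (G y).

Let nU x : U x -> \forall y \near x, U y.
Proof. by move=> Ux; exact: open_nbhs_nbhs. Qed.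

Lemma G_unit y : U y -> G y \in unitmx.
Proof. by move=> Uy; rewrite unitmxE unitfE gt_eqF// detG. Qed.

Definition dG k x := \matrix_(i, j)
  (dot (partial k (partial i f) x) (partial j f x) +
   dot (partial i f x) (partial k (partial j f) x)).

Lemma is_derive_G k x : U x -> is_derive x (delta_mx 0 k) G (dG k x).
Proof.
move=> Ux; have [h1 h2 h3] := f2; apply/is_derive_mxP => i j.
apply: (@near_eq_is_derive _ _ _ (fun y => dot (partial i f y) (partial j f y))).
  by apply: filterS (nU Ux) => y Uy; rewrite GE.
by rewrite mxE; apply: is_derive_dot; apply: derivableP; apply: diff_derivable; exact: h2.
Qed.

Let w y : R := Num.sqrt (\det (G y)).

Let w_gt0 y : U y -> 0 < w y.
Proof. by move=> Uy; rewrite sqrtr_gt0 detG. Qed.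

Lemma G_sym x i j : U x -> G x i j = G x j i.
Proof. by move=> Ux; exact: etrans (GE Ux i j) (etrans (dotC _ _) (esym (GE Ux j i))). Qed.

Lemma invG_sym x i j : U x -> invmx (G x) i j = invmx (G x) j i.
Proof.
move=> Ux; have -> : invmx (G x) i j = (invmx (G x))^T j i by rewrite mxE.
rewrite trmx_inv; congr (invmx _ _ _).
by apply/matrixP => a b; rewrite mxE G_sym.
Qed.

(** Jacobi's formula gives [w / 2] times the trace of [dG G^-1]. The two terms of [dG] contribute
    equally because [G^-1] is symmetric, which absorbs the factor 1/2. *)
Lemma is_derive_w k x : U x ->
  is_derive x (delta_mx 0 k) w (w x * \sum_i \sum_j invmx (G x) i j *
    dot (partial j f x) (partial k (partial i f) x)).
Proof.
move=> Ux.
have := @is_derive_sqrt _ _ (fun y => \det (G y)) _ _ _ (detG Ux) (is_derive_det (is_derive_G k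
  Ux)).
congr is_derive; rewrite adj_unitmx ?G_unit// -scalemxAr mxtraceZ.
have e : \tr (dG k x *m invmx (G x)) = 2 * \sum_i \sum_j invmx (G x) i j *
    dot (partial j f x) (partial k (partial i f) x).
  rewrite mulr2n mulrDl mul1r {2}exchange_big /= -big_split /=; apply: eq_bigr => i _.
  rewrite mxE -big_split /=; apply: eq_bigr => j _.
  rewrite mxE [X in _ = _ + X * _](invG_sym _ _ Ux) -mulrDr mulrC [invmx _ j i](invG_sym _ _ Ux).
  by rewrite dotC.
rewrite e mulrA mulrCA mulrA; congr (_ * _).
have w0 := w_gt0 Ux; rewrite -/(w x) -[\det _]sqr_sqrtr ?ltW ?detG// -/(w x).
by field; rewrite gt_eqF.
Qed.

(* The first-order coefficients of the Laplacian in these coordinates. *)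
Definition drift j x := (w x)^-1 *
  \sum_i partial i (fun y => w y * invmx (G y) i j : R) x.

Lemma derivable_winv i j k x : U x ->
  derivable (fun y => w y * invmx (G y) i j) x (delta_mx 0 k).
Proof.
move=> Ux; apply: derivableM; first by have [] := is_derive_w k Ux.
apply: derivable_invmx; first by have [] := is_derive_G k Ux.
by apply: filterS (nU Ux) => y; exact: G_unit.
Qed.

Lemma laplacian_expand (F : 'rV[R]_n -> R) x : U x ->
  (forall j, differentiable (partial j F) x) ->
  (w x)^-1 * \sum_i partial i
    (fun y => w y * \sum_j invmx (G y) i j * partial j F y) x =
  \sum_i \sum_j invmx (G x) i j * partial i (partial j F) x +
  \sum_j drift j x * partial j F x.
Proof.
move=> Ux dF.
have e i : partial i (fun y => w y * \sum_j invmx (G y) i j * partial j F y) x =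
    \sum_j (w x * invmx (G x) i j * partial i (partial j F) x +
      partial i (fun y => w y * invmx (G y) i j) x * partial j F x).
  rewrite (_ : (fun y => w y * _) =
      fun y => \sum_j (w y * invmx (G y) i j) * partial j F y); last first.
    by apply/funext => y; rewrite mulr_sumr; apply: eq_bigr => j _; rewrite mulrA.
  apply: derive_val; apply: is_derive_sumf => j.
  have := @is_deriveM _ _ _ _ _ _ _ _ (derivableP (@derivable_winv i j i _ Ux))
     (derivableP (@diff_derivable _ _ _ _ _ (delta_mx 0 i) (dF j))).
  by rewrite /GRing.scale /= [partial j F x * _]mulrC.
under eq_bigr do rewrite e big_split /=.
rewrite big_split /= mulrDr; congr (_ + _).
  rewrite mulr_sumr; apply: eq_bigr => i _; rewrite mulr_sumr; apply: eq_bigr => j _.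
  by rewrite !mulrA mulVf ?mul1r// gt_eqF// w_gt0.
rewrite exchange_big /= mulr_sumr; apply: eq_bigr => j _.
by rewrite -mulr_suml mulrA.
Qed.

(** The Laplace-Beltrami operator applied to each component of [f], in the form of
    [laplacian_expand]. For an isometric immersion it turns out to be the mean curvature vector. *)
Definition vector_laplacian x := \sum_i \sum_j invmx (G x) i j *: partial i (partial j f) x
  + \sum_j drift j x *: partial j f x.

(* Differentiate [\sum_j w g^ij g_jk = w delta_ik], with Jacobi's formula for [w],
   the square root of the determinant of the metric. *)
Lemma vector_laplacian_normal k x : U x ->
  dot (vector_laplacian x) (partial k f x) = 0.
Proof.
move=> Ux; have [h1 h2 h3] := f2.
have e1 i : w x * (\sum_j invmx (G x) i j * (dG i x j k)) +
    \sum_j partial i (fun y => w y * invmx (G y) i j) x * G x j k =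
    (i == k)%:R * (w x * \sum_i \sum_j invmx (G x) i j *
    dot (partial j f x) (partial k (partial i f) x)).
  have d1 : is_derive x (delta_mx 0 i) (fun y => \sum_j w y * invmx (G y) i j * G y j k)
    (\sum_j ((w x * invmx (G x) i j) * dG i x j k +
       partial i (fun y => w y * invmx (G y) i j) x * G x j k)).
    apply: is_derive_sumf => j.
    have := @is_deriveM _ _ _ _ _ _ _ _ (derivableP (@derivable_winv i j i _ Ux))
      ((is_derive_mxP _ _ _ _).1 (is_derive_G i Ux) j k).
    by rewrite /GRing.scale /= [G x j k * _]mulrC.
  have d2 : is_derive x (delta_mx 0 i) (fun y => \sum_j w y * invmx (G y) i j * G y j k)
    ((i == k)%:R * (w x * \sum_i \sum_j invmx (G x) i j *
    dot (partial j f x) (partial k (partial i f) x))).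
    apply: (@near_eq_is_derive _ _ _ (fun y => (i == k)%:R * w y)).
      apply: filterS (nU Ux) => y Uy.
      under eq_bigr do rewrite -mulrA; rewrite -mulr_sumr mulrC; congr (_ * _).
      have /matrixP/(_ i k) := mulVmx (G_unit Uy).
      by rewrite !mxE => ->.
    have [->|ik] := eqVneq i k.
      have := is_derive_w k Ux; rewrite mul1r; congr is_derive.
      by apply/funext => y; rewrite mul1r.
    rewrite mul0r (_ : (fun _ => _) = cst 0) ?mul0r; first exact: is_derive_cst.
    by apply/funext => y; rewrite mul0r.
  move: (@derive_val _ _ _ _ _ _ _ d2); rewrite (@derive_val _ _ _ _ _ _ _ d1) => <-.
  by rewrite big_split /= mulr_sumr; congr (_ + _); apply: eq_bigr => j _; rewrite mulrA.
have e2 : \sum_j drift j x * G x j k =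
   (w x)^-1 * \sum_i \sum_j partial i (fun y => w y * invmx (G y) i j) x * G x j k.
  rewrite exchange_big /= mulr_sumr; apply: eq_bigr => j _.
  by rewrite -mulr_suml mulrA.
rewrite /vector_laplacian dotDl !dot_suml.
under [X in _ + X]eq_bigr do rewrite dotZl -GE//.
rewrite e2.
have e3 i : \sum_j partial i (fun y => w y * invmx (G y) i j) x * G x j k =
   (i == k)%:R * (w x * \sum_i \sum_j invmx (G x) i j *
    dot (partial j f x) (partial k (partial i f) x)) -
   w x * (\sum_j invmx (G x) i j * (dG i x j k)).
  by rewrite -e1 addrC addKr.
under [X in _ + _ * X]eq_bigr do rewrite e3.
have e4 (A : R) (B : 'I_n -> R) : \sum_i ((i == k)%:R * A - B i) = A - \sum_i B i.
  rewrite sumrB (bigD1 k)//= eqxx mul1r [X in _ + X - _]big1 ?addr0// => i /negPf ->.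
  by rewrite mul0r.
rewrite e4 -mulr_sumr -mulrBr mulrA mulVf ?mul1r ?gt_eqF ?w_gt0//.
rewrite -sumrB -big_split big1 // => i _ /=.
rewrite dot_suml -sumrB -big_split big1// => j _ /=.
(* [dG i] yields [<d_i d_j f, d_k f>] and [<d_j f, d_i d_k f>]: the first cancels the second-order
   term, the second cancels the derivative of [w] once [d_k d_i = d_i d_k]. *)
rewrite dotZl mxE mulrDr (partial_sym k i oU f2 Ux).
ring.
Qed.

(** This is the trace of [G^-1 G]. It is the squared gradient in the Laplacian of [dot f f], and the
    origin of the dimension in [n / lambda]. *)
Lemma trace_first_form x : U x ->
  \sum_i \sum_j invmx (G x) i j * dot (partial j f x) (partial i f x) = n%:R.
Proof.
move=> Ux; have /matrixP h := mulVmx (G_unit Ux).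
rewrite -[in RHS](card_ord n) -sumr_const; apply: eq_bigr => i _.
by have := h i i; rewrite !mxE eqxx => h1; rewrite -[RHS]h1; apply: eq_bigr => j _; rewrite GE.
Qed.

(** With [G = J J^T] for the Jacobian [J], the matrix [B = G^-1 J] satisfies [B B^T = G^-1]. *)
Lemma invG_gram x : U x -> exists B : 'M[R]_(n, m),
  forall i j, invmx (G x) i j = \sum_k B i k * B j k.
Proof.
move=> Ux; pose J := \matrix_(i < n, k < m) partial i f x 0 k.
have GJ : G x = J *m J^T.
  apply/matrixP => i j; rewrite GE// mxE; apply: eq_bigr => k _; by rewrite !mxE.
exists (invmx (G x) *m J) => i j.
have -> : invmx (G x) i j = ((invmx (G x) *m J) *m (invmx (G x) *m J)^T) i j.
  rewrite trmx_mul mulmxA -[_ *m J *m _]mulmxA -GJ mulVmx ?G_unit// mul1mx mxE.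
  exact: invG_sym.
by rewrite mxE; apply: eq_bigr => k _; rewrite [in X in _ * X]mxE.
Qed.

(* The Hessian of [F - dot f f] is nonnegative at its minimum [x], and the inverse
   metric is a Gram matrix, so the trace of their product is nonnegative. *)
Lemma laplacian_touching (F : 'rV[R]_n -> R) (N : set 'rV[R]_n) x : U x ->
  nbhs x N -> C2_on N F -> F x = dot (f x) (f x) ->
  (forall y, N y -> dot (f y) (f y) <= F y) ->
  2 * (n%:R + dot (vector_laplacian x) (f x)) <=
  (w x)^-1 * \sum_i partial i
    (fun y => w y * \sum_j invmx (G y) i j * partial j F y) x.
Proof.
move=> Ux nN [F1 F2 F3] Fx Fge; have [h1 h2 h3] := f2.
pose u y := dot (f y) (f y).
have du y : U y -> differentiable u y by move=> Uy; apply: differentiable_dot; exact: h1.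
have pu j y : U y -> partial j u y = 2 * dot (partial j f y) (f y).
  move=> Uy; apply: derive_val.
  have d := derivableP (@diff_derivable _ _ _ _ _ (delta_mx 0 j) (h1 _ Uy)).
  have := is_derive_dot d d; congr is_derive.
  by rewrite [dot (f y) _]dotC mulr2n mulrDl mul1r.
have ppu j : differentiable (partial j u) x /\ forall i,
    partial i (partial j u) x =
    2 * (dot (partial i (partial j f) x) (f x) + dot (partial j f x) (partial i f x)).
  have npu : \forall y \near x, 2 * dot (partial j f y) (f y) = partial j u y.
    by apply: filterS (nU Ux) => y Uy; rewrite pu.
  split.
    apply: near_eq_differentiable npu _.
    by apply: differentiableM => //; apply: differentiable_dot; [exact: h2|exact: h1].
  move=> i; apply: derive_val; apply: near_eq_is_derive npu _.
  have := @is_deriveZ _ _ _ _ 2 _ _ _ (is_derive_dot (derivableP (@diff_derivable _ _ _ _ _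
    (delta_mx 0 i) (h2 j _ Ux)))
    (derivableP (@diff_derivable _ _ _ _ _ (delta_mx 0 i) (h1 _ Ux)))).
  by [].
have Nx : N x by exact: nbhs_singleton.
have nUN : nbhs x (U `&` N) by apply: filterI => //; exact: nU.
have dFu y : (U `&` N) y -> differentiable (fun z => F z - u z) y.
  by move=> [Uy Ny]; apply: differentiableB; [exact: F1|exact: du].
have pFu j y : (U `&` N) y -> partial j (fun z => F z - u z) y = partial j F y - partial j u y.
  by move=> [Uy Ny]; apply: deriveB; apply: diff_derivable; [exact: F1|exact: du].
have nFu j : \forall y \near x, partial j F y - partial j u y = partial j (fun z => F z - u z) y.
  by apply: filterS nUN => y Uy; rewrite pFu.
have ddFu j : differentiable (partial j (fun z => F z - u z)) x.
  apply: near_eq_differentiable (nFu j) _.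
  by apply: differentiableB; [exact: F2|exact: (ppu j).1].
have ppFu i j : partial i (partial j (fun z => F z - u z)) x =
    partial i (partial j F) x - partial i (partial j u) x.
  rewrite [LHS](esym (near_eq_derive _ (nFu j))).
  by apply: deriveB; apply: diff_derivable; [exact: F2|exact: (ppu j).1].
have [|e0 hess] := hessian_at_min nUN dFu ddFu.
  by move=> y [Uy Ny]; rewrite Fx subrr subr_ge0; exact: Fge.
(* First-order condition: [F] and [u] have the same gradient at [x], so the drift terms cancel and
   only second derivatives remain to be compared. *)
have e1 j : partial j F x = 2 * dot (partial j f x) (f x).
  by rewrite -pu//; apply/eqP; rewrite -subr_eq0 -pFu// e0.
rewrite laplacian_expand//; last by move=> j; exact: F2.
have [B BE] := invG_gram Ux.
have h4 : 0 <= \sum_i \sum_j invmx (G x) i j * partial i (partial j (fun z => F z - u z)) x.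
  rewrite (eq_bigr (fun i => \sum_j \sum_k B i k * B j k *
      partial i (partial j (fun z => F z - u z)) x)); last first.
    by move=> i _; apply: eq_bigr => j _; rewrite BE mulr_suml.
  rewrite (eq_bigr (fun i => \sum_k \sum_j B i k * B j k *
      partial i (partial j (fun z => F z - u z)) x)); last first.
    by move=> i _; rewrite exchange_big.
  rewrite exchange_big /=; apply: sumr_ge0 => k _.
  (* Each column of [B] is a direction in which the Hessian is nonnegative. *)
  have := hess (\row_i B i k); congr (_ <= _).
  by apply: eq_bigr => i _; apply: eq_bigr => j _; rewrite !mxE.
rewrite -subr_ge0; move: h4; congr (_ <= _).
rewrite /vector_laplacian dotDl !dot_suml.
under [X in _ = _ + X - _]eq_bigr do rewrite e1.
rewrite [X in _ = _ + X - _](_ : _ = 2 * \sum_j dot (drift j x *: partial j f x) (f x)); last first.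
  by rewrite mulr_sumr; apply: eq_bigr => j _; rewrite dotZl mulrCA.
have cancel (a b c d : R) : a + 2 * d - 2 * (b + (c + d)) = a - 2 * (b + c) by ring.
rewrite cancel.
rewrite -(trace_first_form Ux) -big_split /= mulr_sumr -sumrB; apply: eq_bigr => i _.
rewrite dot_suml -big_split /= mulr_sumr -sumrB; apply: eq_bigr => j _.
rewrite ppFu (ppu j).2 dotZl; ring.
Qed.

End CoordinateLaplacian.

(** * Isometric immersions: the normal projection and the mean curvature *)

Section PositiveDefinite.
Context {R : realType} {n : nat}.

Lemma posdef_unitmx (A : 'M[R]_n) :
  (forall v : 'rV[R]_n, v != 0 -> 0 < (v *m A *m v^T) 0 0) -> A \in unitmx.
Proof.
move=> h; rewrite -row_free_unit -kermx_eq0; apply/eqP/row_matrixP => i; rewrite row0.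
apply/eqP; apply/negPn/negP => /h.
by rewrite -row_mul mulmx_ker row0 mul0mx mxE ltxx.
Qed.

(* The determinant does not vanish on the segment from [1%:M] to [A]. *)
Lemma posdef_det_gt0 (A : 'M[R]_n) :
  (forall v : 'rV[R]_n, v != 0 -> 0 < (v *m A *m v^T) 0 0) -> 0 < \det A.
Proof.
move=> h; pose B (t : R) := (1 - t) *: 1%:M + t *: A.
have Bu t : 0 <= t <= 1 -> \det (B t) != 0.
  move=> /andP[t0 t1]; rewrite -unitfE -unitmxE; apply: posdef_unitmx => v v0.
  rewrite /B mulmxDr mulmxDl -!scalemxAr -!scalemxAl mulmx1 !mxE -/(_ 0 0).
  have h1 : 0 < (v *m v^T) 0 0 by rewrite -dotE lt_def dot_ge0 dot_eq0 v0.
  have h2 := h _ v0; move: h1 h2; rewrite !mxE; set a := \sum_j _; set b := \sum_j _ => h1 h2.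
  have [->|tn0] := eqVneq t 0; first by rewrite subr0 mul1r mul0r addr0.
  apply: ltr_wpDl; first by rewrite mulr_ge0 ?subr_ge0// ltW.
  by rewrite mulr_gt0// lt_def tn0.
have B1 : B 1 = A by rewrite /B subrr scale0r add0r scale1r.
have B0 : \det (B 0) = 1 by rewrite /B subr0 scale0r addr0 scale1r det1.
rewrite -B1 ltNge; apply/negP => d1.
have cB t : differentiable (fun s : R => \det (B s)) t.
  apply: differentiable_det => i j; rewrite /B.
  rewrite (_ : (fun s => _) = fun s => (1 - s) * (1%:M : 'M[R]_n) i j + s * A i j); last first.
    by apply/funext => s; rewrite !mxE.
  by [].
have [] := @IVT R (fun s => \det (B s)) 0 1 0 ler01.
- by apply: continuous_subspaceT => t; exact: differentiable_continuous.
- by rewrite B0 ge_min le_max d1 ler01 orbT.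
- by move=> t; rewrite in_itv/= => /Bu /eqP.
Qed.

End PositiveDefinite.

Section ImmersionAnalysis.
Context {R : realType} {n m : nat} {M : riemannianManifold R n}.
Variable X : M -> 'rV[R]_m.
Hypothesis iX : isometric_immersion X.

Notation cod a := (chart_cod (man_chart (a : man_index M))).
Notation rep a := (local_rep X a).

Lemma coord_cod (p : M) : cod (chart_at p) (Defs.coord p).
Proof. by exists p => //; exact: chart_at_dom. Qed.

Lemma cod_open a : open (cod a).
Proof. exact: chart_cod_open. Qed.

Lemma local_rep_coord T (F : M -> T) (p : M) : local_rep F (chart_at p) (Defs.coord p) = F p.
Proof. by rewrite /local_rep /= chart_mapK//; exact: chart_at_dom. Qed.

Lemma local_rep_C2 a : C2_on (cod a) (rep a).
Proof. by apply: Ck_on_C2; have := iX.1 2 a; rewrite setIT. Qed.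

Lemma metric_gram a x : cod a x -> forall i j,
  metric a x i j = dot (partial i (rep a) x) (partial j (rep a) x).
Proof.
move=> ax i j; have [h1 h2 h3] := local_rep_C2 a.
rewrite -(iX.2 a x ax).2 mxE; apply: eq_bigr => k _.
by rewrite -!row_jacobian ?mxE//; exact: h1.
Qed.

Lemma det_metric_gt0 a x : cod a x -> 0 < \det (metric a x).
Proof. by move=> ax; apply: posdef_det_gt0 => v; exact: metric_posdef. Qed.

(** Vectors are rows, so the projection on the normal space acts by multiplication on the right. *)
Definition normal_proj a x : 'M[R]_m :=
  let J := 'J (rep a) x in 1%:M - J^T *m invmx (J *m J^T) *m J.

Lemma normal_partE p v : normal_part X p v = v *m normal_proj (chart_at p) (Defs.coord p).
Proof. by rewrite /normal_proj mulmxBr mulmx1 !mulmxA. Qed.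

Lemma jacobian_normal_proj a x : cod a x -> 'J (rep a) x *m normal_proj a x = 0.
Proof.
move=> ax; rewrite /normal_proj mulmxBr mulmx1 !mulmxA mulmxV ?mul1mx ?subrr//.
by rewrite (iX.2 a x ax).2; rewrite unitmxE unitfE gt_eqF// det_metric_gt0.
Qed.

Lemma normal_proj_sym a x : (normal_proj a x)^T = normal_proj a x.
Proof.
rewrite /normal_proj linearB /= trmx1 !trmx_mul trmxK trmx_inv trmx_mul trmxK.
by rewrite mulmxA.
Qed.

Lemma normal_proj_idem a x : cod a x ->
  normal_proj a x *m normal_proj a x = normal_proj a x.
Proof.
move=> ax; rewrite {1}/normal_proj mulmxBl mul1mx -!mulmxA jacobian_normal_proj//.
by rewrite !mulmx0 subr0.
Qed.

(** The projection is symmetric and idempotent. Through this identity [<H, X> = - lambda <X^N, X>]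
    becomes [- lambda] times a square. *)
Lemma dot_normal_part p v :
  dot (normal_part X p v) v = dot (normal_part X p v) (normal_part X p v).
Proof.
rewrite normal_partE !dotE trmx_mul normal_proj_sym mulmxA; congr ((_ *m _) _ _).
by rewrite -mulmxA normal_proj_idem//; exact: coord_cod.
Qed.

Lemma dot_normal_part_le p v :
  dot (normal_part X p v) (normal_part X p v) <= dot v v.
Proof.
have := dot_ge0 (v - normal_part X p v); have := dot_normal_part p v.
move: (normal_part X p v) => N e.
by rewrite dotDl !dotDr !dotNl !dotNr opprK [dot v N]dotC e; lra.
Qed.

(** In fact [Delta X = H]. The vector Laplacian [L] is normal, so projecting leaves it unchanged,
    while the projection kills the tangential drift terms and turns the second partials into the
    second fundamental form. *)
Lemma dot_vector_laplacian p :
  dot (vector_laplacian (rep (chart_at p)) (metric (chart_at p)) (Defs.coord p)) (X p) =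
  dot (mean_curvature X p) (X p).
Proof.
set a := chart_at p; set x  := Defs.coord p; have ax : cod a x := coord_cod p.
have f2 := local_rep_C2 a; have [h1 h2 h3] := f2.
set L := vector_laplacian _ _ _.
have LJ : L *m ('J (rep a) x)^T = 0.
  apply/rowP => k; rewrite [RHS]mxE.
  have := @vector_laplacian_normal _ _ _ (cod a) (rep a) (metric a) (@cod_open a) f2
    (fun y => @metric_gram a y) (fun y => @det_metric_gt0 a y) k x ax.
  rewrite -/L -row_jacobian; last exact: h1.
  by move=> h; rewrite -[RHS]h mxE; apply: eq_bigr => i _; rewrite !mxE.
have LP : L = L *m normal_proj a x.
  by rewrite /normal_proj mulmxBr mulmx1 !mulmxA LJ !mul0mx subr0.
suff -> : mean_curvature X p = L *m normal_proj a x by rewrite -LP.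
rewrite /L /vector_laplacian mulmxDl.
have -> : (\sum_j drift (metric a) j x *: partial j (rep a) x) *m normal_proj a x = 0.
  rewrite mulmx_suml big1// => j _; rewrite -scalemxAl -row_jacobian; last exact: h1.
  by rewrite -row_mul jacobian_normal_proj// row0 scaler0.
rewrite addr0 mulmx_suml; apply: eq_bigr => i _; rewrite mulmx_suml; apply: eq_bigr => j _.
by rewrite /second_fundamental_form normal_partE -scalemxAl.
Qed.

Lemma local_nbhs (p : M) (N : set M) : open N -> N p ->
  nbhs (Defs.coord p) (chart_map (man_chart (chart_at p)) @` (chart_dom (man_chart (chart_at p))
    `&` N)).
Proof.
move=> oN Np; have ax := coord_cod p.
have h1 : nbhs (Defs.coord p) (chart_inv (man_chart (chart_at p)) @^-1` N).
  have c := chart_inv_continuous ax; apply: c.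
  by rewrite chart_mapK; [exact: open_nbhs_nbhs|exact: chart_at_dom].
have h2 : nbhs (Defs.coord p) (cod (chart_at p)) by apply: open_nbhs_nbhs; split=> //;
  exact: cod_open.
move: h1 h2; apply: filterS2 => y /= Ny [q dq qy]; exists q => //; split=> //.
by move: Ny; rewrite -qy chart_mapK.
Qed.

(** The viscosity form of [Delta |X|^2 = 2 (n + <H, X>)]. It serves twice: for arbitrary test
    functions, to get subharmonicity, and for a constant one, to get the reverse estimate. *)
Lemma laplacian_sqr_touching (p : M) (N : set M) (phi : M -> R) :
  open N -> N p -> Ck_map_on 2 N phi -> phi p = dot (X p) (X p) ->
  (forall q, N q -> dot (X q) (X q) <= phi q) ->
  2 * (n%:R + dot (mean_curvature X p) (X p)) <= laplacian phi p.
Proof.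
move=> oN Np phi2 phip phige; rewrite -dot_vector_laplacian.
set a := chart_at p; set x  := Defs.coord p; have ax : cod a x := coord_cod p.
rewrite -[X in dot _ X](local_rep_coord X p).
have := (@laplacian_touching _ _ _ (cod a) (rep a) (metric a) (@cod_open a)
  (local_rep_C2 a) (fun y => @metric_gram a y) (fun y => @det_metric_gt0 a y) _ _ x ax
    (local_nbhs oN Np)).
rewrite /laplacian /laplacian_in.
apply.
- exact/Ck_on_C2/phi2.
- by rewrite !local_rep_coord.
- by move=> _ [q [dq Nq] <-]; rewrite /local_rep /= chart_mapK//; exact: phige.
Qed.

Lemma immersion_continuous : continuous X.
Proof.
move=> p; have ax := coord_cod p; have dp := chart_at_dom p.
have [h1 h2 h3] := local_rep_C2 (chart_at p).
have c : {for p, continuous (rep (chart_at p) \o chart_map (man_chart (chart_at p)))}.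
  apply: continuous_comp; first exact: chart_map_continuous.
  by apply: differentiable_continuous; exact: h1.
rewrite /continuous_at -(local_rep_coord X p).
apply: cvg_trans c; apply: (near_eq_cvg (F := nbhs p)).
have : nbhs p (chart_dom (man_chart (chart_at p))).
  by apply: open_nbhs_nbhs; split=> //; exact: chart_dom_open.
by apply: filterS => q dq; rewrite /local_rep /= chart_mapK.
Qed.

End ImmersionAnalysis.

(** * Parabolicity makes the norm of the immersion constant *)

Lemma laplacian_cst (R : realType) (n : nat) (M : riemannianManifold R n) (c : R) (p : M) :
  laplacian (fun _ => c) p = 0.
Proof.
rewrite /laplacian /laplacian_in /local_rep big1 ?mulr0// => i _.
rewrite (_ : (fun y => _) = cst 0); first exact: derive_cst.
apply/funext => y; rewrite big1 ?mulr0// => j _.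
by rewrite /partial (derive_cst c) mulr0.
Qed.

Lemma Ck_on_cst (R : realType) (n : nat) (V : normedModType R) k (U : set 'rV[R]_n) (c : V) :
  Ck_on k U (fun _ => c).
Proof.
elim: k c => [|k IH] c /=; first by move=> x _; exact: cst_continuous.
split=> [x _|i]; first exact: differentiable_cst.
rewrite (_ : partial i _ = fun _ => 0)//.
by apply/funext => x; exact: derive_cst.
Qed.

Lemma shrinker_norm (R : realType) (n : nat) (Sigma : riemannianManifold R n)
    (X : Sigma -> 'rV[R]_n.+1) (lambda rad : R) :
  0 < lambda -> connected_manifold Sigma -> self_shrinker lambda X ->
  parabolic Sigma -> (forall p : Sigma, enorm (X p) <= rad) ->
  rad <= Num.sqrt (n%:R / lambda) ->
  forall p, enorm (X p) = Num.sqrt (n%:R / lambda).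
Proof.
move=> l0 [[p0 _] _] [_ iX _ HX] par hrad rle p.
have rad0 : 0 <= rad := le_trans (enorm_ge0 (X p0)) (hrad p0).
have nl0 : 0 <= n%:R / lambda by rewrite divr_ge0// ltW.
have dle q : lambda * dot (X q) (X q) <= n%:R.
  rewrite mulrC -ler_pdivlMr// -sqr_enorm -[leRHS]sqr_sqrtr// ler_pXn2r ?nnegrE//.
  - exact: le_trans rle.
  - exact: enorm_ge0.
have Hd q : dot (mean_curvature X q) (X q) = - lambda * dot (normal_part X q (X q)) (normal_part
  X q (X q)).
  by rewrite HX dotZl dot_normal_part.
pose u q := dot (X q) (X q).
have cu : continuous u.
  move=> q; apply: (@continuous_comp _ _ _ X (fun y => dot y y)); first exact: immersion_continuous.
  by apply: differentiable_continuous; apply: differentiable_dot.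
have su : subharmonic u.
  move=> q N phi oN Nq phi2 phiq phige.
  apply: le_trans (laplacian_sqr_touching iX oN Nq phi2 phiq phige).
  (* The lower bound is [2 (n - lambda |X^N|^2)], nonnegative by [|X^N| <= |X|] and the ball
     hypothesis in the form [dle]. *)
  rewrite mulr_ge0// Hd mulNr subr_ge0 (le_trans _ (dle q))// ler_wpM2l ?(ltW l0)//.
  exact: dot_normal_part_le.
have ub : exists C : R, forall q, u q <= C.
  exists (n%:R / lambda) => q.
  by rewrite ler_pdivlMr// mulrC; exact: dle.
have uc := par u cu su ub.
(* As [u] is constant, the constant [u p] is a test function, with Laplacian 0. Hence
   [n <= lambda |X^N|^2 <= lambda * u p <= n]. *)
have := @laplacian_sqr_touching _ _ _ _ X iX p setT (fun _ => u p) openT I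
  (fun a => @Ck_on_cst _ _ _ 2 _ (u p)) erefl (fun q _ => _).
rewrite laplacian_cst Hd pmulr_rle0// mulNr subr_le0 => h.
have /le_anti e : lambda * u p <= n%:R <= lambda * u p.
  rewrite dle (le_trans (h _))//; first by move=> q; rewrite -/(u q) (uc q p).
  by rewrite ler_wpM2l ?(ltW l0)// dot_normal_part_le.
by rewrite /enorm -/(u p); congr Num.sqrt; rewrite -e mulrAC mulfV ?mul1r// gt_eqF.
Qed.

(** * Local geometry of immersions into a sphere *)

Section LocalImmersion.
Context {R : realType} {n : nat}.

Lemma nbhs_distP (V : normedModType R) (x : V) (A : set V) :
  nbhs x A <-> exists2 d : R, 0 < d & forall z, `|z - x| < d -> A z.
Proof.
split=> [/nbhs_normP [d /= d0 hd]|[d d0 hd]].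
  by exists d => // z zx; apply: hd; rewrite /ball_ /= distrC.
by apply/nbhs_normP; exists d => // z; rewrite /ball_ /= distrC; exact: hd.
Qed.

Lemma enorm_sum m I (r : seq I) (P : pred I) (F : I -> 'rV[R]_m) :
  enorm (\sum_(i <- r | P i) F i) <= \sum_(i <- r | P i) enorm (F i).
Proof.
elim/big_ind2 : _ => [|a b c d h1 h2|//]; first by rewrite enorm0.
by rewrite (le_trans (enormD _ _))// lerD.
Qed.

Lemma enorm_mulmx_le k m (A : 'M[R]_(k, m)) :
  exists2 K, 0 < K & forall u : 'rV_k, enorm (u *m A) <= K * enorm u.
Proof.
pose K := \sum_(i < k) enorm (row i A).
have K0 : 0 <= K by apply: sumr_ge0 => i _; exact: enorm_ge0.
exists (K + 1) => [|u]; first by rewrite ltr_wpDl.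
rewrite mulmx_sum_row (le_trans (enorm_sum _ _ _))//.
apply: (@le_trans _ _ (K * enorm u)); last by rewrite ler_wpM2r ?enorm_ge0// lerDl.
rewrite /K mulr_suml; apply: ler_sum => i _; rewrite enormZ mulrC ler_wpM2l ?enorm_ge0//.
exact: le_trans (coord_le_norm _ _) (norm_le_enorm _).
Qed.

Variables (m : nat) (U : set 'rV[R]_n) (f : 'rV[R]_n -> 'rV[R]_m).
Hypothesis oU : open U.
Hypothesis f2 : C2_on U f.

Lemma partial_continuous i x : U x -> {for x, continuous (partial i f)}.
Proof. by move=> Ux; have [_ h _] := f2; apply: differentiable_continuous; exact: h. Qed.

Lemma near_derivative x0 e : U x0 -> 0 < e ->
  exists2 d, 0 < d & forall z, `|z - x0| < d -> U z /\
    forall v, enorm ('D_v f z - 'D_v f x0) <= e * enorm v.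
Proof.
move=> Ux0 e0; have [h1 h2 h3] := f2.
(* Summing over the partial derivatives costs a factor [n], passing from the sup norm to [enorm] a
   factor [m]; the 1 keeps the denominator positive. *)
have e1 : 0 < e / (n%:R * m%:R + 1).
  by rewrite divr_gt0// ltr_wpDl// mulr_ge0.
have nx : \forall z \near x0, U z /\ forall i,
  `|partial i f x0 - partial i f z| < e / (n%:R * m%:R + 1).
  apply: filterI; first exact: open_nbhs_nbhs.
  apply: (@filter_forall _ _ (fun i z => `|partial i f x0 - partial i f z| < e / (n%:R * m%:R +
    1)) (nbhs x0)) => i; have /cvgrPdist_lt := @partial_continuous i x0 Ux0.
  exact.
have [d d0 hd] := (nbhs_distP _ _).1 nx.
exists d => // z /hd[Uz hz].
split=> // v; rewrite (derive_partial v (h1 _ Uz)) (derive_partial v (h1 _ Ux0)) -sumrB.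
rewrite (le_trans (enorm_sum _ _ _))//.
apply: (@le_trans _ _ (\sum_(i < n) m%:R * (e / (n%:R * m%:R + 1)) * enorm v)).
  apply: ler_sum => i _; rewrite -scalerBr enormZ mulrC ler_pM ?enorm_ge0//; last first.
    exact: le_trans (coord_le_norm _ _) (norm_le_enorm _).
  by rewrite (le_trans (enorm_le_norm _))// ler_wpM2l// distrC ltW.
rewrite sumr_const card_ord -[leLHS]mulr_natl !mulrA ler_wpM2r ?enorm_ge0//.
by rewrite ler_pdivrMr ?ltr_wpDl ?mulr_ge0// [leRHS]mulrC ler_wpM2r ?(ltW e0)// lerDl.
Qed.

Lemma ball_convex (z : 'rV[R]_n) d x y (s : R) : 0 <= s <= 1 ->
  `|x - z| < d -> `|y - z| < d -> `|x + s *: (y - x) - z| < d.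
Proof.
move=> /andP[s0 s1] xd yd.
have -> : x + s *: (y - x) - z = (1 - s) *: (x - z) + s *: (y - z).
  by apply/rowP => i; rewrite !mxE; ring.
rewrite (le_lt_trans (ler_normD _ _))// !normrZ (ger0_norm s0) ger0_norm ?subr_ge0//.
have -> : d = (1 - s) * d + s * d by ring.
have [->|sn0] := eqVneq s 0; first by rewrite subr0 !mul1r !mul0r !addr0.
by apply: ler_ltD; [rewrite ler_wpM2l ?subr_ge0// ltW|rewrite ltr_pM2l// lt_def sn0].
Qed.

(** The mean value theorem is scalar, so it is applied to [<f, u>] with [u] the error itself;
    Cauchy-Schwarz then bounds [|u|^2] by [e |y - x| |u|]. *)
Lemma near_increment x0 d e : (forall z, `|z - x0| < d -> U z /\
    forall v, enorm ('D_v f z - 'D_v f x0) <= e * enorm v) ->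
  forall x y, `|x - x0| < d -> `|y - x0| < d ->
  enorm (f y - f x - 'D_(y - x) f x0) <= e * enorm (y - x).
Proof.
move=> hd x y xd yd; have [h1 h2 h3] := f2.
set u := f y - f x - _.
have seg t : 0 <= t <= 1 -> `|x + t *: (y - x) - x0| < d by move=> t01; exact: ball_convex.
have [t|t /andP[t0 t1] e1] := @mean_value_segment R n (fun z => dot (f z) u) x y.
  by move=> /seg/hd[Uz _]; apply: differentiable_dot => //; exact: h1.
have /seg/hd[Uz hz] : 0 <= t <= 1 by rewrite !ltW.
have e2 : 'D_(y - x) (fun z => dot (f z) u) (x + t *: (y - x)) =
    dot ('D_(y - x) f (x + t *: (y - x))) u.
  apply: derive_val.
  have := is_derive_dot (derivableP (@diff_derivable _ _ _ _ _ (y - x) (h1 _ Uz)))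
    (is_derive_cst u (x + t *: (y - x)) (y - x)).
  by rewrite [dot _ 0]dotC dot0l addr0.
have e3 : dot u u = dot ('D_(y - x) f (x + t *: (y - x)) - 'D_(y - x) f x0) u.
  by rewrite {1}/u !dotDl !dotNl -e2 -e1.
have [->|u0] := eqVneq u 0; first by rewrite enorm0 (le_trans (enorm_ge0 _) (hz _)).
have eu : 0 < enorm u by rewrite lt_def enorm_eq0 u0 enorm_ge0.
rewrite -(ler_pM2r eu) -expr2 sqr_enorm e3 (le_trans (cauchy_schwarz _ _))//.
by rewrite ler_pM2r.
Qed.

(** A right inverse of [J] gives [|v| <= K |'D_v f x0|]. Where the differential moves by at most
    [1 / (2 K)], this implies [|'D_(y - x) f x0| <= 2 |f y - f x|]. Hence the constant [2 K], and at
    other points [z] the constant [3 = 2 * 3/2]. *)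
Lemma immersion_bounds x0 : U x0 -> row_free ('J f x0) ->
  exists d K, [/\ 0 < d, 0 < K, forall z, `|z - x0| < d -> U z,
    forall x y, `|x - x0| < d -> `|y - x0| < d -> enorm (y - x) <= K * enorm (f y - f x) &
    forall x y z, `|x - x0| < d -> `|y - x0| < d -> `|z - x0| < d ->
      enorm ('D_(y - x) f z) <= 3 * enorm (f y - f x)].
Proof.
move=> Ux0 free0; have [h1 h2 h3] := f2; set J := 'J f x0 in free0.
have [K K0 hK] := enorm_mulmx_le (pinvmx J).
have hJ v : enorm v <= K * enorm ('D_v f x0).
  rewrite deriveEjacobian ?(le_trans _ (hK _))//; last exact: h1.
  by rewrite -mulmxA mulmxVp// mulmx1.
have e0 : 0 < (2 * K)^-1 by rewrite invr_gt0 mulr_gt0.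
have [d d0 hd] := near_derivative Ux0 e0.
have hz v : (2 * K)^-1 * enorm v <= enorm ('D_v f x0) / 2.
  rewrite ler_pdivrMl ?mulr_gt0//; have := hJ v.
  by congr (_ <= _); field.
have hinc x y : `|x - x0| < d -> `|y - x0| < d -> enorm ('D_(y - x) f x0) <= 2 * enorm (f y - f x).
  move=> xd yd; have := near_increment hd xd yd; set u := _ - _ - _ => hu.
  have : enorm ('D_(y - x) f x0) <= enorm (f y - f x) + enorm u.
    by rewrite -[enorm u]enormN (le_trans _ (enormD _ _))// /u opprB subrKC.
  by have := hz (y - x); lra.
exists d, (2 * K); split=> //.
- by rewrite mulr_gt0.
- by move=> z /hd[].
- by move=> x y xd yd; rewrite (le_trans (hJ _))// [2 * K]mulrC -mulrA ler_pM2l// hinc.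
- move=> x y z xd yd /hd[Uz hz'].
  have arith (a b c g h : R) : h <= g -> g <= b / 2 -> b <= 2 * c -> a <= b + h -> a <= 3 * c.
    by lra.
  apply: (arith _ _ _ _ _ (hz' (y - x)) (hz (y - x)) (hinc _ _ xd yd)).
  by rewrite (le_trans _ (enormD _ _))// subrKC.
Qed.

End LocalImmersion.

(** [A] has rank [n] in dimension [n + 1], so the kernel of [A^T] is a line. *)
Lemma normal_line (F : fieldType) (n : nat) (A : 'M[F]_(n, n.+1)) (u v : 'rV[F]_n.+1) :
  row_free A -> u *m A^T = 0 -> v *m A^T = 0 -> u != 0 -> exists c, v = c *: u.
Proof.
move=> fA hu hv u0.
have rk : \rank (kermx A^T) = 1%N.
  by rewrite mxrank_ker mxrank_tr (eqP fA) subSnn.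
have su : (u <= kermx A^T)%MS by apply/sub_kermxP.
have sv : (v <= kermx A^T)%MS by apply/sub_kermxP.
apply/sub_rVP; apply: submx_trans sv _.
have /leqif_trans := mxrank_leqif_sup su.
have [_ ] := mxrank_leqif_sup su; rewrite rk rank_rV u0 eqxx => /esym //.
Qed.

(* The point of the image which is closest to [y] is [y] itself: the difference
   is normal there, and the normal line meets the sphere in two antipodal points. *)
Lemma spherical_immersion_open (R : realType) (n : nat) (U : set 'rV[R]_n)
    (f : 'rV[R]_n -> 'rV[R]_n.+1) (r : R) x0 e :
  open U -> C2_on U f -> (forall x, U x -> row_free ('J f x)) -> 0 < r ->
  (forall x, U x -> enorm (f x) = r) -> U x0 -> 0 < e ->
  exists2 d, 0 < d & forall y, enorm y = r -> enorm (y - f x0) < d ->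
    exists2 x, `|x - x0| < e & U x /\ f x = y.
Proof.
move=> oU f2 free r0 fr Ux0 e0; have [h1 h2 h3] := f2.
have [d [K [d0 K0 dU hK _]]] := immersion_bounds oU f2 Ux0 (free _ Ux0).
pose s := Num.min d e / 2.
have m0 : 0 < Num.min d e by rewrite lt_min d0.
have s0 : 0 < s by rewrite divr_gt0.
have sm : s < Num.min d e by rewrite ltr_pdivrMr// ltr_pMr// ltr1n.
have [sd se] : s < d /\ s < e by apply/andP; rewrite -lt_min.
(* The second bound makes the minimizer interior: [|x1 - x0| <= K |f x1 - f x0| <= 2 K |y - f x0| <
   s]. The bound [r] excludes the antipode of [y], which is at distance [2 r]. *)
exists (Num.min r (s / (2 * K))); first by rewrite lt_min r0 divr_gt0// mulr_gt0.
move=> y yr; rewrite lt_min => /andP[yer yK].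
pose B := [set x : 'rV[R]_n | `|x - x0| <= s].
have BU x : B x -> U x by move=> Bx; apply: dU; exact: le_lt_trans sd.
have cB : compact B.
  have -> : B = closed_ball_ Num.Def.normr x0 s.
    by apply/seteqP; split=> x; rewrite /closed_ball_ /B /= distrC.
  apply: bounded_closed_compact; last exact: closed_closed_ball_.
  exists (`|x0| + s); split; first exact: num_real.
  move=> N hN x; rewrite /closed_ball_ /= => xs; rewrite (le_trans _ (ltW hN))//.
  by rewrite -[x](subrKC x0) (le_trans (ler_normD _ _))// lerD2l distrC.
pose h x := dot (f x - y) (f x - y).
have dh x : U x -> differentiable h x.
  move=> Ux; apply: differentiable_dot;
    by apply: differentiableB; [exact: h1|exact: differentiable_cst].
have B0 : B x0 by rewrite /B /= subrr normr0 ltW.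
have [|x1] := @EVT_min_rV R n h B (ex_intro _ x0 B0) cB.
  apply: continuous_in_subspaceT => x /[!inE] /BU Ux.
  exact/differentiable_continuous/dh.
rewrite inE => Bx1 hmin; have Ux1 := BU _ Bx1.
have he x : h x = enorm (f x - y) ^+ 2 by rewrite sqr_enorm.
have l1 : enorm (f x1 - y) <= enorm (y - f x0).
  have := hmin x0; rewrite inE => /(_ B0); rewrite !he ler_pXn2r ?nnegrE ?enorm_ge0//.
  by rewrite [enorm (f x0 - y)]enormB.
have l2 : `|x1 - x0| < s.
  apply: (le_lt_trans (norm_le_enorm _)).
  apply: (@le_lt_trans _ _ (K * enorm (f x1 - f x0))).
    by apply: hK; rewrite ?subrr ?normr0//; exact: le_lt_trans sd.
  rewrite -ltr_pdivlMl//.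
  have : enorm (f x1 - f x0) <= enorm (f x1 - y) + enorm (y - f x0).
    by rewrite (le_trans _ (enormD _ _))// subrKA.
  have -> : K^-1 * s = s / (2 * K) + s / (2 * K) by field; rewrite gt_eqF.
  lra.
have nB : nbhs x1 B.
  apply/nbhs_distP; exists (s - `|x1 - x0|) => [|z zx]; first by rewrite subr_gt0.
  by rewrite /B /= (le_trans (ler_distD x1 _ _))// -lerBrDr ltW.
have crit j : dot (partial j f x1) (f x1 - y) = 0.
  have e1 : 'D_(delta_mx 0 j) h x1 = 0.
    apply: (@derive_at_min _ _ _ _ _ B nB) => z Bz; first exact/dh/BU.
    by apply: hmin; rewrite inE.
  have df : is_derive x1 (delta_mx 0 j) (fun z => f z - y) (partial j f x1).
    have := is_deriveB (derivableP (@diff_derivable _ _ _ _ _ (delta_mx 0 j) (h1 _ Ux1)))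
      (is_derive_cst y x1 (delta_mx 0 j)).
    by rewrite subr0.
  have e2 := is_derive_dot df df.
  move: e1; rewrite (@derive_val _ _ _ _ _ _ _ e2) [dot (f x1 - y) _]dotC => e1.
  lra.
(* [|f|^2] is constant, so the position vector is normal too; hence [y] is normal as well. *)
have tang j : dot (partial j f x1) (f x1) = 0.
  have df := derivableP (@diff_derivable _ _ _ _ _ (delta_mx 0 j) (h1 _ Ux1)).
  have e1 := is_derive_dot df df.
  have e2 : is_derive x1 (delta_mx 0 j) (fun z => dot (f z) (f z)) 0.
    have nr : \forall z \near x1, cst (r ^+ 2) z = dot (f z) (f z).
      by apply: filterS (open_nbhs_nbhs (conj oU Ux1)) => z Uz; rewrite -sqr_enorm fr.
    exact: near_eq_is_derive nr (is_derive_cst _ _ _).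
  move: (@derive_val _ _ _ _ _ _ _ e1); rewrite (@derive_val _ _ _ _ _ _ _ e2).
  by rewrite [dot (f x1) _]dotC => e3; lra.
have toJ u : (forall j, dot (partial j f x1) u = 0) -> u *m ('J f x1)^T = 0.
  move=> hu; apply/rowP => j; rewrite [RHS]mxE -[RHS](hu j) dotC -row_jacobian; last exact: h1.
  by rewrite mxE; apply: eq_bigr => i _; rewrite !mxE.
have f0 : f x1 != 0 by rewrite -enorm_eq0 fr// gt_eqF.
have yJ : y *m ('J f x1)^T = 0.
  by apply: toJ => j; have := crit j; rewrite dotDr dotNr tang; lra.
have [c ycf] := normal_line (free _ Ux1) (toJ _ tang) yJ f0.
exists x1; first exact: lt_trans se.
split=> //.
have c1 : `|c| = 1.
  have : `|c| * r = r by rewrite -[in RHS]yr ycf enormZ fr.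
  by move/(canRL (mulfK (lt0r_neq0 r0))); rewrite divff// gt_eqF.
have : c == 1 \/ c == -1.
  by apply/orP; rewrite -sqrf_eq1 -real_normK ?num_real// c1 expr1n.
move=> [/eqP c11|/eqP c11]; first by rewrite ycf c11 scale1r.
have := le_lt_trans l1 yer.
rewrite ycf c11 scaleN1r opprK -mulr2n -scaler_nat enormZ fr// ger0_norm//.
by move: r0; clear => r0 r2; exfalso; lra.
Qed.

(** * Curves and the Riemannian distance *)

Section CurveCalculus.
Context {R : realType} {n m : nat}.

Lemma continuous_at_sum (T : topologicalType) (V : normedModType R) I (r : seq I)
    (F : I -> T -> V) t : (forall i, {for t, continuous (F i)}) ->
  {for t, continuous (fun s => \sum_(i <- r) F i s)}.
Proof.
move=> cF; elim: r => [|i r IH].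
  have -> : (fun s : T => \sum_(i <- [::]) F i s) = cst 0 by apply/funext => s; rewrite big_nil.
  exact: cst_continuous.
have -> : (fun s : T => \sum_(j <- i :: r) F j s) = F i + (fun s => \sum_(j <- r) F j s).
  by apply/funext => s; rewrite big_cons.
exact: continuousD.
Qed.

Lemma derivable_comp_curve (U : set 'rV[R]_n) (f : 'rV[R]_n -> 'rV[R]_m) (c : R ->
  'rV[R]_n) (t : R) :
  open U -> C2_on U f -> U (c t) ->
  (\forall s \near t, derivable c (s : R) 1) -> {for t, continuous ('D_1 c)} ->
  (\forall s \near t, is_derive (s : R) 1 (f \o c) ('D_('D_1 c s) f (c s))) /\
  {for t, continuous ('D_1 (f \o c))}.
Proof.
move=> oU f2 Uc dc cc; have [h1 h2 h3] := f2.
have ct : {for t, continuous c}.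
  by apply: differentiable_continuous; apply/derivable1_diffP; exact: nbhs_singleton dc.
have nU : \forall s \near t, U (c s) by apply: ct; exact: open_nbhs_nbhs.
have nd : \forall s \near t, is_derive (s : R) 1 (f \o c) ('D_('D_1 c s) f (c s)).
  move: nU dc; apply: filterS2 => s Us /derivable1_diffP ds.
  have df := h1 _ Us.
  apply: DeriveDef; first by apply/derivable1_diffP; exact: differentiable_comp.
  rewrite deriveE; last exact: differentiable_comp.
  by rewrite diff_comp//= -!deriveE.
split=> //.
have e : \forall s \near t, \sum_i 'D_1 c s 0 i *: partial i f (c s) = 'D_1 (f \o c) s.
  move: nU nd; apply: filterS2 => s Us ds.
  by rewrite (@derive_val _ _ _ _ _ _ _ ds) derive_partial//; exact: h1.
have e0 := nbhs_singleton e.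
have cs : {for t, continuous (fun s => \sum_i 'D_1 c s 0 i *: partial i f (c s))}.
  apply: continuous_at_sum => i; apply: continuousZ.
    exact: (@continuous_comp _ _ _ ('D_1 c) (fun N : 'rV_n => N 0 i) t cc (@coord_continuous _ _
      _ 0 i _)).
  exact: (@continuous_comp _ _ _ c (partial i f) t ct (@partial_continuous _ _ _ _ _ f2 i _ Uc)).
rewrite /prop_for /continuous_at -e0.
exact: cvg_trans (near_eq_cvg e) cs.
Qed.

End CurveCalculus.

Section CurveLength.
Context {R : realType} {n m : nat} {M : riemannianManifold R n}.
Variable X : M -> 'rV[R]_m.
Hypothesis iX : isometric_immersion X.

(** Since [J J^T] is the metric, lengths in [M] are Euclidean lengths of image curves, and charts
    disappear from the length estimates. *)
Lemma immersion_curve (gamma : R -> M) : C1_curve gamma -> forall t : R,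
  [/\ derivable (X \o gamma) t 1, {for t, continuous ('D_1 (X \o gamma))} &
     speed gamma t = enorm ('D_1 (X \o gamma) t)].
Proof.
move=> [cg dg] t; set a := chart_at (gamma t).
have da : chart_dom (man_chart a) (gamma t) by exact: chart_at_dom.
pose c : R -> 'rV_n := chart_map (man_chart a) \o gamma.
have nd : \forall s \near t, chart_dom (man_chart a) (gamma s).
  by apply: cg; apply: open_nbhs_nbhs; split=> //; exact: chart_dom_open.
have dc : \forall s \near t, derivable c s 1.
  by apply: filterS nd => s /dg[].
have cc : {for t, continuous ('D_1 c)} by have [] := dg a t da.
have Uc : chart_cod (man_chart a) (c t) by exists (gamma t).
have f2 := local_rep_C2 iX a; have [h1 _ _] := f2.
have [hd hc] := derivable_comp_curve (@cod_open _ _ _ a) f2 Uc dc cc.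
have nX : \forall s \near t, \forall z \near s, (local_rep X a \o c) z = (X \o gamma) z.
  have oD : open [set s | chart_dom (man_chart a) (gamma s)].
    by apply: open_comp => [s _|]; [exact: cg|exact: chart_dom_open].
  apply: filterS (open_nbhs_nbhs (conj oD da)) => s ds.
  by apply: filterS (open_nbhs_nbhs (conj oD ds)) => z dz; rewrite /local_rep /c /= chart_mapK.
have dX : \forall s \near t, is_derive (s : R) 1 (X \o gamma) ('D_('D_1 c s) (local_rep X a) (c s)).
  by move: nX hd; apply: filterS2 => s; exact: near_eq_is_derive.
have e0 := nbhs_singleton dX.
split.
- by case: e0.
- have e1 : \forall s \near t, 'D_1 (local_rep X a \o c) s = 'D_1 (X \o gamma) s.
    by apply: filterS nX => s; exact: near_eq_derive.
  rewrite /prop_for /continuous_at -(nbhs_singleton e1).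
  exact: cvg_trans (near_eq_cvg e1) hc.
- rewrite (@derive_val _ _ _ _ _ _ _ e0) deriveEjacobian; last exact: h1.
  rewrite /speed /enorm dotE trmx_mul mulmxA -/a -/c -[_ *m 'J _ _ *m _]mulmxA.
  by rewrite (iX.2 a _ Uc).2.
Qed.

Lemma continuous_enorm k : continuous (@enorm R k).
Proof.
move=> u; apply: (@continuous_comp _ _ _ (fun v => dot v v) Num.sqrt).
  by apply: differentiable_continuous; apply: differentiable_dot.
exact: sqrt_continuous.
Qed.

Lemma continuous_speed (gamma : R -> M) : C1_curve gamma -> continuous (speed gamma).
Proof.
move=> cg t; have -> : speed gamma = fun t => enorm ('D_1 (X \o gamma) t).
  by apply/funext => s; have [] := immersion_curve cg s.
have [_ c _] := immersion_curve cg t.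
by apply: (@continuous_comp _ _ _ ('D_1 (X \o gamma)) (@enorm R m)) => //; exact: continuous_enorm.
Qed.

Lemma speed_ge0 (gamma : R -> M) t : 0 <= speed gamma t.
Proof. exact: sqrtr_ge0. Qed.

Lemma measurable_speed (gamma : R -> M) (D : set (measurableTypeR R)) : C1_curve gamma ->
  measurable_fun D (fun t => (speed gamma t)%:E).
Proof.
move=> cg; apply/measurable_EFinP; apply: measurable_funTS; apply: continuous_measurable_fun.
exact: continuous_speed.
Qed.

Lemma curve_length_ge0 (gamma : R -> M) : (0 <= curve_length gamma)%E.
Proof. by apply: integral_ge0 => t _; rewrite lee_fin speed_ge0. Qed.

Lemma curve_length_le (gamma : R -> M) K : C1_curve gamma ->
  (forall t, 0 <= t <= 1 -> speed gamma t <= K) -> (curve_length gamma <= K%:E)%E.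
Proof.
move=> cg hK; rewrite /curve_length.
apply: (@le_trans _ _ (\int[@lebesgue_measure R]_(t in `[0%R, 1%R]) (cst K%:E) t)%E).
  apply: ge0_le_integral => //=.
  - by move=> t _; rewrite lee_fin speed_ge0.
  - exact: measurable_speed.
by rewrite integral_cst//= lebesgue_measure_itv/= lte_fin ltr01 sube0 mule1.
Qed.

(** Integrate the component of [X o gamma] along the unit vector of the displacement; its derivative
    is at most the speed. The start [a] is free so that final arcs of [gamma] are covered. *)
Lemma immersion_dist_le_length (gamma : R -> M) a t : C1_curve gamma ->
  0 <= a -> a <= t -> t <= 1 ->
  ((enorm (X (gamma t) - X (gamma a)))%:E <= curve_length gamma)%E.
Proof.
move=> cg a0 t0 t1; set u := _ - _.
have [->|u0] := eqVneq u 0; first by rewrite enorm0 curve_length_ge0.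
have [tz|tn0] := eqVneq t a; first by move: u0; rewrite /u tz subrr eqxx.
have tgt0 : a < t by rewrite lt_def tn0.
have eu : 0 < enorm u by rewrite lt_def enorm_eq0 u0 enorm_ge0.
pose v := (enorm u)^-1 *: u.
have ev : enorm v = 1 by rewrite enormZ ger0_norm ?invr_ge0 ?enorm_ge0// mulVf// gt_eqF.
pose h s := dot (X (gamma s)) v.
have dh (s : R) : is_derive s 1 h (dot ('D_1 (X \o gamma) s) v).
  have [d _ _] := immersion_curve cg s.
  have := is_derive_dot (derivableP d) (is_derive_cst v s 1).
  by rewrite [dot _ 0]dotC dot0l addr0.
have ch : continuous h.
  by move=> s; apply: differentiable_continuous; apply/derivable1_diffP; case: (dh s).
have cdh : continuous (fun s => dot ('D_1 (X \o gamma) s) v).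
  move=> s; have [_ c _] := immersion_curve cg s.
  apply: (@continuous_comp _ _ _ ('D_1 (X \o gamma)) (fun w => dot w v)) => //.
  apply: differentiable_continuous; apply: differentiable_dot => //.
have e1 : h t - h a = enorm u.
  rewrite /h -dotNl -dotDl dotZr -/u -sqr_enorm expr2 mulrA mulVf ?mul1r// gt_eqF//.
rewrite -e1 EFinB -(@continuous_FTC2 R (fun s => dot ('D_1 (X \o gamma) s) v) h a t)//.
- apply: (@le_trans _ _ (\int[@lebesgue_measure R]_(s in `[a, t]) (speed gamma s)%:E)%E).
    apply: le_integral => //=.
    + by apply: continuous_compact_integrable; [exact: segment_compact|exact: continuous_subspaceT].
    + apply: continuous_compact_integrable; first exact: segment_compact.
      by apply: continuous_subspaceT => ?; exact: continuous_speed.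
    + move=> s _; rewrite lee_fin; have [_ _ ->] := immersion_curve cg s.
      by rewrite (le_trans (cauchy_schwarz _ _))// ev mulr1.
  apply: ge0_subset_integral => //=.
  - exact: measurable_speed.
  - by move=> s _; rewrite lee_fin speed_ge0.
  - by move=> s /=; rewrite !in_itv/= => /andP[h1 h2]; rewrite (le_trans a0 h1) (le_trans h2 t1).
- exact: continuous_subspaceT.
- split; first by move=> s _; case: (dh s).
  + by apply: cvg_at_right_filter; exact: ch.
  + by apply: cvg_at_left_filter; exact: ch.
- by move=> s _; rewrite derive1E; case: (dh s).
Qed.

End CurveLength.

Section ChartCurves.
Context {R : realType} {n : nat}.

(* [C1_curve] constrains a curve on the whole line: [ramp] keeps the parameter of
   a chord in [[-1, 1]] while still running through [[0, 1]]. *)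
Definition ramp (t : R) : R := 2 * t / (1 + t ^+ 2).

Definition dramp (t : R) : R := 2 * (1 - t ^+ 2) / (1 + t ^+ 2) ^+ 2.

Let ramp_den (t : R) : 0 < 1 + t ^+ 2.
Proof. by rewrite ltr_wpDr ?sqr_ge0. Qed.

Lemma is_derive_ramp (t : R) : is_derive t 1 ramp (dramp t).
Proof.
have h1 : is_derive t 1 (fun s : R => 1 + s ^+ 2) (2 * t).
  have := @is_deriveD _ _ _ _ _ _ _ _ _ (is_derive_cst (1 : R) t 1)
    (@is_deriveX _ _ id 2 t 1 1 (is_derive_id t 1)).
  congr is_derive; rewrite add0r /GRing.scale /= expr1 mulr1; ring.
have h2 : is_derive t 1 (fun s : R => (1 + s ^+ 2)^-1) (- (1 + t ^+ 2) ^- 2 * (2 * t)).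
  have [dh1 eh1] := h1; apply: DeriveDef; first exact: (@derivableV _ _ (fun s : R => 1 + s ^+ 2)
    t 1 (lt0r_neq0 (ramp_den t)) dh1).
  by rewrite (@deriveV _ _ (fun s : R => 1 + s ^+ 2) t 1 (lt0r_neq0 (ramp_den t)) dh1) eh1.
have h3 := @is_deriveZ _ _ _ id 2 t 1 1 (is_derive_id t 1).
have := @is_deriveM _ _ _ _ _ _ _ _ h3 h2.
congr is_derive.
have := ramp_den t; rewrite /dramp /GRing.scale /= => t0.
by change (2 *: t) with (2 * t); field; rewrite gt_eqF.
Qed.

Lemma ramp_bound t : `|ramp t| <= 1.
Proof.
have h1 : 0 <= (1 - t) ^+ 2 by rewrite sqr_ge0.
have h2 : 0 <= (1 + t) ^+ 2 by rewrite sqr_ge0.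
rewrite ler_norml /ramp ler_pdivrMr// ler_pdivlMr//; apply/andP; split; lra.
Qed.

Lemma dramp_bound t : `|dramp t| <= 2.
Proof.
have h1 : 0 <= t ^+ 2 by rewrite sqr_ge0.
have h2 : 0 <= t ^+ 2 * t ^+ 2 by rewrite mulr_ge0.
have h0 : 0 < (1 + t ^+ 2) ^+ 2 by rewrite exprn_gt0.
rewrite ler_norml /dramp ler_pdivrMr// ler_pdivlMr//; apply/andP; split; nra.
Qed.

Lemma ramp0 : ramp 0 = 0.
Proof. by rewrite /ramp mulr0 mul0r. Qed.

Lemma ramp1 : ramp 1 = 1.
Proof. by rewrite /ramp expr1n mulr1 divff. Qed.

Lemma dramp_continuous : continuous dramp.
Proof.
move=> t; have c : {for t, continuous (fun s : R => 2 * (1 - s ^+ 2))}.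
  by apply: differentiable_continuous.
apply: (continuousM c).
apply: continuousV; first by rewrite expf_neq0// gt_eqF.
by apply: differentiable_continuous.
Qed.

Definition chord (x v : 'rV[R]_n) (t : R) := x + ramp t *: v.

Lemma is_derive_chord x v (t : R) : is_derive t 1 (chord x v) (dramp t *: v).
Proof.
apply/is_derive_mxP => i j; rewrite /chord mxE.
have h := @is_deriveM _ _ _ _ _ _ _ _ (is_derive_ramp t) (is_derive_cst (v i j) t 1).
have := @is_deriveD _ _ _ _ _ _ _ _ _ (is_derive_cst (x i j) t 1) h.
congr is_derive; first by apply/funext => s; rewrite !mxE.
by rewrite /GRing.scale /= mulr0 !add0r mulrC.
Qed.

Lemma derive_chord x v (t : R) : 'D_1 (chord x v) t = dramp t *: v.
Proof. exact: (@derive_val _ _ _ _ _ _ _ (is_derive_chord x v t)). Qed.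

Lemma chord_continuous x v : continuous (chord x v).
Proof.
move=> t; apply: differentiable_continuous; apply/derivable1_diffP.
by case: (is_derive_chord x v t).
Qed.

Lemma derive_chord_continuous x v : continuous ('D_1 (chord x v)).
Proof.
have -> : 'D_1 (chord x v) = fun t => dramp t *: v by apply/funext => t; exact: derive_chord.
by move=> t; apply: continuousZ; [exact: dramp_continuous|exact: cst_continuous].
Qed.

Variable M : riemannianManifold R n.
Implicit Types (a b : man_index M) (p q : M).

Lemma nbhs_chart_dom a p : chart_dom (man_chart a) p -> nbhs p (chart_dom (man_chart a)).
Proof. by move=> dp; apply: open_nbhs_nbhs; split=> //; exact: chart_dom_open. Qed.

Lemma overlap_open a b : open (overlap (man_chart a) (man_chart b)).
Proof.
rewrite openE => _ [p [ap bp] <-].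
have cx : chart_cod (man_chart a) (chart_map (man_chart a) p) by exists p.
have h1 : nbhs (chart_map (man_chart a) p) (chart_inv (man_chart a) @^-1` chart_dom (man_chart b)).
  by apply: (chart_inv_continuous cx); rewrite chart_mapK//; exact: nbhs_chart_dom.
have h2 : nbhs (chart_map (man_chart a) p) (chart_cod (man_chart a)).
  by apply: open_nbhs_nbhs; split=> //; exact: chart_cod_open.
move: h1 h2; apply: filterS2 => y /= yb [q dq qy]; exists q => //; split=> //.
by move: yb; rewrite -qy chart_mapK.
Qed.

(** [C1_curve] tests the curve in every chart [b]; there it is the chord followed by the transition
    map, which is C2 on the open overlap. *)
Lemma chart_chord_C1 a x v :
  (forall t, chart_cod (man_chart a) (chord x v t)) ->
  C1_curve (chart_inv (man_chart a) \o chord x v).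
Proof.
move=> cod; split=> [t|b t dt].
  by apply: continuous_comp; [exact: chord_continuous|exact: chart_inv_continuous].
have Ut : overlap (man_chart a) (man_chart b) (chord x v t).
  have [p ap e] := cod t; exists p => //; split=> //.
  by move: dt; rewrite /= -e chart_mapK.
have T2 : C2_on (overlap (man_chart a) (man_chart b)) (transition (man_chart a) (man_chart b)).
  exact/Ck_on_C2/man_compatible.
have [||h1 h2] := derivable_comp_curve (@overlap_open a b) T2 Ut.
- by apply: filterE => s; case: (is_derive_chord x v s).
- exact: derive_chord_continuous.
split; last exact: h2.
by case: (nbhs_singleton h1).
Qed.

End ChartCurves.

Section ShortPaths.
Context {R : realType} {n : nat} {M : riemannianManifold R n}.

(** A witness replaces the infimum, so that bounds add up under concatenation. The path runs from
    [p] to [q]. *)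
Definition short_path (p q : M) (c : R) := exists2 l, joined q p l & (l <= c%:E)%E.

Lemma joined_trans (p q s : M) l l' : joined q p l -> joined s q l' -> joined s p (l + l')%E.
Proof.
move=> h hs; elim: h => [|gamma l1 cg _ IH]; first by rewrite add0e.
by rewrite -addeA; apply: joined_step.
Qed.

Lemma short_path_trans (p q s : M) c d :
  short_path p q c -> short_path q s d -> short_path p s (c + d).
Proof.
move=> [l h1 h2] [l' h1' h2']; exists (l + l')%E; first exact: joined_trans h1 h1'.
by rewrite EFinD leeD.
Qed.

Lemma short_path_dist (p q : M) c : short_path p q c -> (riemannian_distance p q <= c%:E)%E.
Proof. move=> [l h1 h2]; have h := @ereal_inf_lbound R [set l | joined q p l] l h1.
exact: le_trans h h2. Qed.

Variables (X : M -> 'rV[R]_n.+1) (r : R).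
Hypothesis iX : isometric_immersion X.
Hypothesis r0 : 0 < r.
Hypothesis Xr : forall p, enorm (X p) = r.

(** The chart chord from [s] to [q] has speed at most [2 * 3 |X q - X s|]: 2 bounds [dramp] and 3
    comes from [immersion_bounds], which also gives injectivity. *)
Lemma local_isometry_chart (p : M) : exists W : set M, [/\ open W, W p,
  forall q s, W q -> W s -> X q = X s -> q = s &
  forall q s, W q -> W s -> short_path s q (6 * enorm (X q - X s))].
Proof.
set a := chart_at p; set x0 := Defs.coord p.
have ax : chart_cod (man_chart a) x0 := coord_cod p.
have f2 := local_rep_C2 iX a; have [h1 _ _] := f2.
have [d [K [d0 K0 dU hK hD]]] := immersion_bounds (@cod_open _ _ _ a) f2 ax (iX.2 a _ ax).1.
pose cm := chart_map (man_chart a).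
(* Since [ramp] takes values in [-1, 1], the chord also extends backwards from [s]; its points stay
   within [d / 3 + 2 (d / 3)] of [x0]. *)
pose W := [set q | chart_dom (man_chart a) q /\ `|cm q - x0| < d / 3].
have d3 : 0 < d / 3 by rewrite divr_gt0.
have Wd q : W q -> `|cm q - x0| < d by move=> [_ h];
  rewrite (lt_trans h)// ltr_pdivrMr// ltr_pMr// ltr1n.
have repK q : W q -> local_rep X a (cm q) = X q.
  by move=> [dq _]; rewrite /local_rep /= chart_mapK.
exists W; split.
- rewrite openE => q [dq hq].
  have h2 : nbhs q (cm @^-1` [set y | `|y - x0| < d / 3]).
    apply: (chart_map_continuous dq); apply/nbhs_distP.
    exists (d / 3 - `|cm q - x0|) => [|z hz]; first by rewrite subr_gt0.
    by rewrite /= (le_lt_trans (ler_distD (cm q) _ _))// -ltrBrDr.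
  by move: (nbhs_chart_dom dq) h2; apply: filterS2 => z dz hz; split.
- by split; [exact: chart_at_dom|rewrite /cm subrr normr0].
- move=> q s Wq Ws e.
  have := hK _ _ (Wd _ Ws) (Wd _ Wq).
  rewrite (repK _ Wq) (repK _ Ws) e subrr enorm0 mulr0 => e0.
  have /eqP : enorm (cm q - cm s) == 0 by rewrite eq_le e0 enorm_ge0.
  move=> /eqP; rewrite enorm_eq0 subr_eq0 => /eqP cqs.
  by rewrite -(chart_mapK Wq.1) -(chart_mapK Ws.1) -/cm cqs.
- move=> q s Wq Ws; pose v := cm q - cm s.
  have hball t : `|chord (cm s) v t - x0| < d.
    rewrite /chord addrAC (le_lt_trans (ler_normD _ _))//.
    have -> : d = d / 3 + 2 * (d / 3) by field.
    rewrite ltr_leD//; first by case: Ws.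
    rewrite normrZ (@le_trans _ _ (1 * `|v|))// ?ler_wpM2r ?ramp_bound// mul1r.
    rewrite /v (le_trans (ler_distD x0 _ _))// mulr2n mulrDl mul1r.
    by rewrite lerD ?ltW//; [case: Wq|rewrite distrC; case: Ws].
  have cod t : chart_cod (man_chart a) (chord (cm s) v t) by exact: dU.
  pose gamma := chart_inv (man_chart a) \o chord (cm s) v.
  have cg : C1_curve gamma := chart_chord_C1 cod.
  have g0 : gamma 0 = s by rewrite /gamma /= /chord ramp0 scale0r addr0 chart_mapK//; case: Ws.
  have g1 : gamma 1 = q.
    by rewrite /gamma /= /chord ramp1 scale1r /v subrKC chart_mapK//; case: Wq.
  exists (curve_length gamma + 0)%E.
    by rewrite -g0; apply: joined_step => //; rewrite g1; exact: joined_refl.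
  rewrite adde0; apply: (curve_length_le iX cg) => t _.
  have [_ _ ->] := immersion_curve iX cg t.
  have -> : 'D_1 (X \o gamma) t = dramp t *: 'D_v (local_rep X a) (chord (cm s) v t).
    have [||hd _] := derivable_comp_curve (@cod_open _ _ _ a) f2 (cod t).
    + by apply: filterE => z; case: (is_derive_chord (cm s) v z).
    + exact: derive_chord_continuous.
    have e := @derive_val _ _ _ _ _ _ _ (nbhs_singleton hd).
    rewrite [LHS]e derive_chord !deriveE; [|exact: h1..].
    by rewrite linearZ.
  rewrite enormZ.
  have := hD _ _ _ (Wd _ Ws) (Wd _ Wq) (hball t).
  rewrite -/v (repK _ Wq) (repK _ Ws) => hD'.
  have -> : 6 * enorm (X q - X s) = 2 * (3 * enorm (X q - X s)) by ring.
  by rewrite ler_pM ?enorm_ge0// dramp_bound.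
Qed.

Lemma immersion_relatively_open (p : M) (O : set M) : open O -> O p ->
  exists2 e, 0 < e & forall y, enorm y = r -> enorm (y - X p) < e ->
    exists2 q, O q & X q = y.
Proof.
move=> oO Op; set a := chart_at p; set x0 := Defs.coord p.
have ax : chart_cod (man_chart a) x0 := coord_cod p.
have f2 := local_rep_C2 iX a.
have [e e0 he] := (nbhs_distP _ _).1 (local_nbhs oO Op).
have fr x : chart_cod (man_chart a) x -> enorm (local_rep X a x) = r by move=> _; exact: Xr.
have free x : chart_cod (man_chart a) x -> row_free ('J (local_rep X a) x).
  by move=> cx; case: (iX.2 a x cx).
have [d d0 hd] := spherical_immersion_open (@cod_open _ _ _ a) f2 free r0 fr ax e0.
exists d => // y yr; rewrite -(local_rep_coord X p) => yd.
have [x /he[q [dq Oq] <-] [_ fx]] := hd y yr yd.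
by exists q => //; rewrite -fx /local_rep /= chart_mapK.
Qed.

(** [tau] inverts [X] locally and has the junk value [p] elsewhere. It is controlled only on the
    sphere, so its continuity is spelled out for points of the sphere. *)
Lemma local_section (p : M) : exists W e (tau : 'rV[R]_n.+1 -> M), 
  [/\ open W /\ W p, 0 < e,
  forall q s, W q -> W s -> X q = X s -> q = s,
  forall q s, W q -> W s -> short_path s q (6 * enorm (X q - X s)) &
  forall y, enorm y = r -> enorm (y - X p) < e ->
   [/\ W (tau y), X (tau y) = y & forall O, nbhs (tau y) O ->
     exists2 d, 0 < d & forall z, enorm z = r -> enorm (z - X p) < e ->
       enorm (z - y) < d -> O (tau z)]].
Proof.
have [W [oW Wp inj short]] := local_isometry_chart p.
have [e e0 he] := immersion_relatively_open oW Wp.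
pose tau y := if pselect (exists q, W q /\ X q = y) is left h then projT1 (cid h) else p.
have tauP y : enorm y = r -> enorm (y - X p) < e -> W (tau y) /\ X (tau y) = y.
  move=> yr ye; rewrite /tau; case: pselect => [h|[]]; first exact: projT2 (cid h).
  by have [q Wq Xq] := he y yr ye; exists q.
exists W, e, tau; split=> // y yr ye.
have [Wt Xt] := tauP y yr ye; split=> // O nO.
have : nbhs (tau y) (O `&` W) by apply: filterI => //; exact: open_nbhs_nbhs.
rewrite nbhsE; case=> O' [oO' O't] sO'.
have [d d0 hd] := immersion_relatively_open oO' O't.
exists d => // z zr ze zd; rewrite Xt in hd.
have [q O'q Xq] := hd z zr zd; have [Oq Wq] := sO' _ O'q.
have [Wz Xz] := tauP z zr ze.
by rewrite (inj _ _ Wz Wq)// Xz.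
Qed.

End ShortPaths.

(** * Lifting maps to the sphere *)

Section IntervalInduction.
Context {R : realType}.

(** Supremum argument on the [t] with [Q a t]. It chains local statements along a segment; near [x]
    only intervals containing [x] have to be treated. *)
Lemma interval_induction (Q : R -> R -> Prop) (a b : R) : a <= b ->
  (forall x y z, a <= x -> x <= y -> y <= z -> z <= b -> Q x y -> Q y z -> Q x z) ->
  (forall x, a <= x <= b -> exists2 d, 0 < d & forall s t,
     a <= s -> s <= x -> x <= t -> t <= b -> x - s < d -> t - x < d -> Q s t) ->
  Q a b.
Proof.
move=> ab trans loc.
pose A := [set t | a <= t <= b /\ Q a t].
have Aa : A a.
  split; first by rewrite lexx.
  have [|d d0 hd] := loc a; first by rewrite lexx.
  by apply: hd; rewrite ?subrr.
have bA : ubound A b by move=> t [/andP[]].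
have supA : has_sup A by split; [exists a|exists b].
have am : a <= sup A by apply: ub_le_sup => //; case: supA.
have mb : sup A <= b by apply: ge_sup => //; exists a.
have [|d d0 hd] := loc (sup A); first by rewrite am.
have [t [/andP[t0 t1] Qt] tm] := sup_adherent d0 supA.
have tle : t <= sup A by apply: ub_le_sup; [case: supA|split=> //; rewrite t0].
have Qm : Q a (sup A).
  apply: (trans a t (sup A)) => //.
  by apply: hd; rewrite ?subrr// ltrBlDl -ltrBlDr.
pose t' := Num.min b (sup A + d / 2).
have mt' : sup A <= t' by rewrite le_min mb lerDl divr_ge0// ltW.
have t'b : t' <= b by rewrite ge_min lexx.
have Qt' : Q a t'.
  apply: (trans a (sup A) t') => //; apply: hd; rewrite ?subrr//.
  rewrite ltrBlDl gt_min ltrD2l ltr_pdivrMr// ltr_pMr// ltr1n orbT//.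
have : t' <= sup A.
  by apply: ub_le_sup; [case: supA|split=> //; rewrite (le_trans am mt')].
rewrite /t' ge_min => /orP[bm|].
  by have <- : sup A = b by apply/eqP; rewrite eq_le mb.
by rewrite gerDl leNgt divr_gt0.
Qed.

End IntervalInduction.

Section Lifts.
Context {R : realType} {n : nat} {M : riemannianManifold R n}.
Variables (X : M -> 'rV[R]_n.+1) (r : R).
Hypothesis iX : isometric_immersion X.
Hypothesis r0 : 0 < r.
Hypothesis Xr : forall p, enorm (X p) = r.

Lemma continuous_at_near (T U : topologicalType) (f g : T -> U) x :
  (\forall y \near x, f y = g y) -> {for x, continuous f} -> {for x, continuous g}.
Proof.
move=> fg cf; rewrite /prop_for /continuous_at -(nbhs_singleton fg).
exact: cvg_trans (near_eq_cvg fg) cf.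
Qed.

(** Near a point of agreement, local injectivity of [X] propagates it. Near a point of disagreement
    the curves stay apart, [M] being Hausdorff, and the implication is vacuous. *)
Lemma lift_unique (c1 c2 : R -> M) (b : R) : 0 <= b ->
  (forall s, 0 <= s <= b -> {for s, continuous c1}) ->
  (forall s, 0 <= s <= b -> {for s, continuous c2}) ->
  (forall s, 0 <= s <= b -> X (c1 s) = X (c2 s)) -> c1 0 = c2 0 -> c1 b = c2 b.
Proof.
move=> b0 k1 k2 kX; apply: (@interval_induction R (fun s t => c1 s = c2 s -> c1 t = c2 t)) => //.
  by move=> x y z _ _ _ _ h1 h2 /h1/h2.
move=> x x01; have [e|ne] := pselect (c1 x = c2 x).
  have [W [oW Wx inj _]] := local_isometry_chart iX (c1 x).
  have nW : \forall s \near x, W (c1 s) /\ W (c2 s).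
    apply: filterI; first by apply: (k1 _ x01); exact: open_nbhs_nbhs.
    by apply: (k2 _ x01); rewrite -e; exact: open_nbhs_nbhs.
  have [d d0 hd] := (nbhs_distP _ _).1 nW.
  exists d => // s t s0 sx xt tb _ td _.
  have [W1 W2] : W (c1 t) /\ W (c2 t) by apply: hd; rewrite ger0_norm ?subr_ge0.
  by apply: inj => //; apply: kX; rewrite tb (le_trans s0 (le_trans sx xt)).
have := @man_hausdorff _ _ M; rewrite open_hausdorff => /(_ _ _ (introN eqP ne)).
move=> [[A B] /= [xA xB] [oA oB /eqP AB]]; rewrite !inE in xA xB.
have nW : \forall s \near x, A (c1 s) /\ B (c2 s).
  by apply: filterI; [apply: (k1 _ x01)|apply: (k2 _ x01)]; exact: open_nbhs_nbhs.
have [d d0 hd] := (nbhs_distP _ _).1 nW.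
exists d => // s t s0 sx xt tb sd _ e.
have [W1 W2] : A (c1 s) /\ B (c2 s) by apply: hd; rewrite distrC ger0_norm ?subr_ge0.
suff : set0 (c1 s) by [].
by rewrite -AB; split=> //; rewrite e.
Qed.

Lemma line_continuous k (x v : 'rV[R]_k) : continuous (fun s : R => x + s *: v).
Proof.
move=> s; have c : {for s, continuous (fun t : R => t *: v)} by exact: scalel_continuous.
by apply: (continuousD _ c); exact: cst_continuous.
Qed.

Lemma lift_unique_segment k (c1 c2 : 'rV[R]_k -> M) x y :
  (forall s : R, 0 <= s <= 1 -> {for x + s *: (y - x), continuous c1}) ->
  (forall s : R, 0 <= s <= 1 -> {for x + s *: (y - x), continuous c2}) ->
  (forall s : R, 0 <= s <= 1 -> X (c1 (x + s *: (y - x))) = X (c2 (x + s *: (y - x)))) ->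
  c1 x = c2 x -> c1 y = c2 y.
Proof.
move=> k1 k2 kX e.
have := @lift_unique (fun s => c1 (x + s *: (y - x))) (fun s => c2 (x + s *: (y - x))) 1 ler01.
rewrite scale0r addr0 scale1r subrKC; apply=> // s s01.
  by apply: (@continuous_comp _ _ _ (fun s : R => x + s *: (y - x)) c1);
    [exact: line_continuous|exact: k1].
by apply: (@continuous_comp _ _ _ (fun s : R => x + s *: (y - x)) c2);
    [exact: line_continuous|exact: k2].
Qed.

Lemma joined_ge0 (q p : M) l : joined q p l -> (0 <= l)%E.
Proof. by elim=> // gamma l' _ _ h; rewrite adde_ge0// curve_length_ge0. Qed.

Lemma section_continuous (T : topologicalType) (h : T -> 'rV[R]_n.+1) (tau : 'rV[R]_n.+1 -> M)
    (p : M) (e : R) x :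
  (forall y, enorm (h y) = r) -> {for x, continuous h} -> enorm (h x - X p) < e ->
  (forall O, nbhs (tau (h x)) O -> exists2 d, 0 < d & forall z, enorm z = r ->
      enorm (z - X p) < e -> enorm (z - h x) < d -> O (tau z)) ->
  {for x, continuous (tau \o h)}.
Proof.
move=> hr ch he htau O /htau[d d0 hd].
have c1 (w : 'rV[R]_n.+1) : {for x, continuous (fun y => enorm (h y - w))}.
  apply: (@continuous_comp _ _ _ (fun y => h y - w) (@enorm R n.+1)); last exact: continuous_enorm.
  by apply: continuousB => //; exact: cst_continuous.
have n1 : \forall y \near x, enorm (h y - X p) < e by have /cvgr_lt := c1 (X p); apply.
have n2 : \forall y \near x, enorm (h y - h x) < d.
  by have /cvgr_lt := c1 (h x); apply; rewrite subrr enorm0.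
by move: n1 n2; apply: filterS2 => y h1 h2; exact: hd.
Qed.

(** The bridge from completeness to topology. A chain of curves from [q] to [p] shorter than [e] has
    its image within [e] of [X p], so by uniqueness of lifts it coincides with its own image under
    [tau o X]. Hence [q = tau (X q)], which is near [p] when [X q] is near [X p]. *)
Lemma distance_nbhs (p : M) (O : set M) : nbhs p O ->
  exists2 e, 0 < e & forall q, (riemannian_distance q p < e%:E)%E -> O q.
Proof.
move=> nO; have [W [e [tau [[oW Wp] e0 inj _ htau]]]] := local_section iX r0 Xr p.
have taup : tau (X p) = p.
  have [|W1 X1 _] := htau (X p) (Xr p); first by rewrite subrr enorm0.
  exact: inj.
have claim q l : joined p q l -> (l < e%:E)%E ->
    q = tau (X q) /\ ((enorm (X q - X p))%:E <= l)%E.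
  elim=> [|gamma l' cg jl IH] le.
    by rewrite taup subrr enorm0.
  have l'0 := joined_ge0 jl.
  have [|e1 d1] := IH.
    by apply: le_lt_trans le; rewrite -[leLHS]add0e leeD2r// curve_length_ge0.
  have dist s : 0 <= s <= 1 -> ((enorm (X (gamma s) - X p))%:E <= curve_length gamma + l')%E.
    move=> /andP[s0 s1].
    apply: (@le_trans _ _ ((enorm (X (gamma 1) - X (gamma s)))%:E + (enorm (X (gamma 1) - X
      p))%:E)%E).
      by rewrite -EFinD lee_fin [enorm (X (gamma 1) - X (gamma s))]enormB
        (le_trans _ (enormD _ _))// subrKA.
    by apply: leeD => //; exact: immersion_dist_le_length.
  have near s : 0 <= s <= 1 -> enorm (X (gamma s) - X p) < e.
    by move=> /dist h; rewrite -lte_fin (le_lt_trans h).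
  split; last by apply: dist; rewrite lexx ler01.
  have Xg : continuous (X \o gamma).
    by move=> s; apply: continuous_comp; [exact: cg.1|exact: immersion_continuous].
  (* Agreement is known at the end [gamma 1], so the curve is run backwards. *)
  have := @lift_unique (fun s => gamma (1 - s)) (fun s => tau (X (gamma (1 - s)))) 1 ler01.
  have rev (s : R) : 0 <= s <= 1 -> 0 <= 1 - s <= 1.
    by move=> /andP[s0 s1]; rewrite subr_ge0 s1 gerBl.
  have crev (s : R) : {for s, continuous (fun u : R => 1 - u)}.
    by apply: continuousB; [exact: cst_continuous|exact: cvg_id].
  rewrite subrr subr0; apply=> // s /rev s01.
  - by apply: (@continuous_comp _ _ _ (fun u : R => 1 - u) gamma); [exact: crev|exact: cg.1].
  - have [_ _ h3] := htau _ (Xr (gamma (1 - s))) (near _ s01).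
    apply: (@section_continuous _ (fun u : R => X (gamma (1 - u))) tau p e s) => //.
    + apply: (@continuous_comp _ _ _ (fun u : R => 1 - u) (X \o gamma)); [exact: crev|exact: Xg].
    + exact: near.
  - by have [_ -> _] := htau _ (Xr (gamma (1 - s))) (near _ s01).
have [|_ _ /(_ O)] := htau (X p) (Xr p); first by rewrite subrr enorm0.
rewrite taup => /(_ nO)[d d0 hd].
exists (Num.min d e); first by rewrite lt_min d0.
move=> q /ereal_inf_lt[l jl]; rewrite EFin_min lt_min => /andP[ld le].
have [qe dq] := claim q l jl le.
rewrite qe; apply: hd => //.
- by rewrite -lte_fin (le_lt_trans dq).
- by rewrite -lte_fin (le_lt_trans dq).
Qed.


Hypothesis cM : complete_manifold M.

Section LiftingMap.
Variables (k : nat) (h : 'rV[R]_k -> 'rV[R]_n.+1) (L : R) (x0 : 'rV[R]_k) (p0 : M).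
Hypothesis L0 : 0 < L.
Hypothesis hr : forall x, enorm (h x) = r.
Hypothesis hL : forall x y, enorm (h x - h y) <= L * `|x - y|.
Hypothesis hp0 : X p0 = h x0.

Let ray (y : 'rV[R]_k) (s : R) := x0 + s *: (y - x0).

Let rayM y s t : ray (ray y s) t = ray y (t * s).
Proof. by rewrite /ray [x0 + _ - x0]addrAC subrr add0r scalerA. Qed.

Let ray1 y : ray y 1 = y.
Proof. by rewrite /ray scale1r subrKC. Qed.

Let ray0 y : ray y 0 = x0.
Proof. by rewrite /ray scale0r addr0. Qed.

Let frac01 (a b : R) : 0 <= a -> a <= b -> 0 < b -> 0 <= a / b <= 1.
Proof. by move=> a0 ab b0; rewrite divr_ge0 ?(ltW b0)//= ler_pdivrMr// mul1r. Qed.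

Lemma lipschitz_continuous : continuous h.
Proof.
move=> x A /nbhs_distP[e e0 he]; apply/nbhs_distP; exists (e / L); first by rewrite divr_gt0.
move=> y yx; apply: he; rewrite (le_lt_trans (norm_le_enorm _))// (le_lt_trans (hL _ _))//.
by rewrite mulrC -ltr_pdivlMr.
Qed.

(** Star-shapedness about [x0] makes two such lifts agree on the whole intersection of their
    domains, by uniqueness along rays. *)
Definition star_lift (U : set 'rV[R]_k) (H : 'rV[R]_k -> M) :=
  [/\ open U, U x0, H x0 = p0,
  forall y (s : R), U y -> 0 <= s <= 1 -> U (ray y s) &
  forall y, U y -> {for y, continuous H} /\ X (H y) = h y].

Lemma star_lift_unique U1 H1 U2 H2 y : star_lift U1 H1 -> star_lift U2 H2 ->
  U1 y -> U2 y -> H1 y = H2 y.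
Proof.
move=> [_ _ e1 st1 c1] [_ _ e2 st2 c2] Uy1 Uy2.
apply: (@lift_unique_segment _ H1 H2 x0 y); last by rewrite e1 e2.
- by move=> s /(st1 _ _ Uy1)/c1[].
- by move=> s /(st2 _ _ Uy2)/c2[].
- by move=> s s01; rewrite (c1 _ (st1 _ _ Uy1 s01)).2 (c2 _ (st2 _ _ Uy2 s01)).2.
Qed.

Lemma dist_ball_open (z : 'rV[R]_k) d : open [set y | `|y - z| < d].
Proof.
rewrite openE => y yd; apply/nbhs_distP; exists (d - `|y - z|); first by rewrite subr_gt0.
by move=> w wy; rewrite /= (le_lt_trans (ler_distD y _ _))// -ltrBrDr.
Qed.

Lemma local_star_lift : exists U H, star_lift U H.
Proof.
have [W [e [tau [[oW Wp] e0 inj _ htau]]]] := local_section iX r0 Xr p0.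
exists [set y | `|y - x0| < e / L], (tau \o h).
have he y : `|y - x0| < e / L -> enorm (h y - X p0) < e.
  by move=> yd; rewrite hp0 (le_lt_trans (hL _ _))// mulrC -ltr_pdivlMr.
have B0 : `|x0 - x0| < e / L by rewrite subrr normr0 divr_gt0.
split=> //.
- exact: dist_ball_open.
- have [W1 X1 _] := htau _ (hr x0) (he _ B0).
  by apply: inj => //; rewrite hp0.
- by move=> y s yd s01; exact: ball_convex.
- move=> y yd; have [W1 X1 h1] := htau _ (hr y) (he _ yd); split=> //.
  by apply: section_continuous (he _ yd) h1 => //; exact: lipschitz_continuous.
Qed.

Lemma maximal_star_lift : exists G H0, star_lift G H0 /\
  forall U H, star_lift U H -> U `<=` G.
Proof.
pose G := [set y | exists U H, star_lift U H /\ U y].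
have ex y : exists p, G y -> exists U H, [/\ star_lift U H, U y & H y = p].
  have [[U [H [sUH Uy]]]|nG] := pselect (G y); last by exists p0.
  by exists (H y) => _; exists U, H.
pose H0 y := projT1 (cid (ex y)).
have H0E U H y : star_lift U H -> U y -> H0 y = H y.
  move=> sUH Uy; rewrite /H0; case: cid => p /= [|U' [H' [sUH' Uy' <-]]].
    by exists U, H.
  exact: star_lift_unique sUH' sUH Uy' Uy.
exists G, H0; split; last by move=> U H sUH y Uy; exists U, H.
have [U0 [H00 s0]] := local_star_lift.
have U0x0 : U0 x0 by case: s0.
split.
- rewrite openE => y [U [H [sUH Uy]]].
  have oU : open U by case: sUH.
  by apply: filterS (open_nbhs_nbhs (conj oU Uy)) => z Uz; exists U, H.
- by exists U0, H00.
- by rewrite (H0E _ _ _ s0 U0x0); case: s0.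
- by move=> y s [U [H [sUH Uy]]] s01; exists U, H; split=> //; case: sUH => _ _ _ st _; exact: st.
- move=> y [U [H [sUH Uy]]]; have [oU _ _ _ cU] := sUH; have [c1 c2] := cU _ Uy.
  split; last by rewrite (H0E _ _ _ sUH Uy).
  apply: continuous_at_near c1.
  by apply: filterS (open_nbhs_nbhs (conj oU Uy)) => z Uz; rewrite (H0E _ _ _ sUH Uz).
Qed.

Let ray_dist y s t : `|ray y s - ray y t| = `|s - t| * `|y - x0|.
Proof. by rewrite /ray opprD addrACA subrr add0r -scalerBl normrZ. Qed.

Let ray_continuous y : continuous (ray y).
Proof. exact: line_continuous. Qed.

(** Chains the local bound with constant 6 along the ray, on which [h] is Lipschitz. Both directions
    are kept because [short_path] is oriented and the Cauchy condition concerns ordered pairs. *)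
Lemma star_lift_short G H0 z (a b : R) : star_lift G H0 ->
  (forall s, 0 <= s < 1 -> G (ray z s)) -> 0 <= a -> a <= b -> b < 1 ->
  let c := 6 * (L * `|z - x0|) * (b - a) in
  short_path (H0 (ray z a)) (H0 (ray z b)) c /\ short_path (H0 (ray z b)) (H0 (ray z a)) c.
Proof.
move=> [oG _ _ _ cG] hz a0 ab b1 /=; set K := 6 * _.
apply: (@interval_induction R (fun s t =>
  short_path (H0 (ray z s)) (H0 (ray z t)) (K * (t - s)) /\
  short_path (H0 (ray z t)) (H0 (ray z s)) (K * (t - s)))) => //.
- move=> s t u _ _ _ _ [h1 h2] [h3 h4].
  have -> : K * (u - s) = K * (t - s) + K * (u - t) by ring.
  by split; [exact: short_path_trans h1 h3|rewrite addrC; exact: short_path_trans h4 h2].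
- move=> x /andP[ax xb].
  have Gx : G (ray z x) by apply: hz; rewrite (le_trans a0 ax) (le_lt_trans xb b1).
  have [cx _] := cG _ Gx.
  have [W [oW Wx _ short]] := local_isometry_chart iX (H0 (ray z x)).
  have nW : \forall s \near x, W (H0 (ray z s)).
    have c : {for x, continuous (H0 \o ray z)}.
      by apply: continuous_comp; [exact: ray_continuous|exact: cx].
    by apply: c; exact: open_nbhs_nbhs.
  have [d d0 hd] := (nbhs_distP _ _).1 nW.
  exists d => // s t as_ sx xt tb sd td.
  have Ws : W (H0 (ray z s)) by apply: hd; rewrite distrC ger0_norm ?subr_ge0.
  have Wt : W (H0 (ray z t)) by apply: hd; rewrite ger0_norm ?subr_ge0.
  have st := le_trans sx xt.
  have GX u : a <= u -> u <= b -> X (H0 (ray z u)) = h (ray z u).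
    by move=> au ub; apply: (cG _ _).2; apply: hz; rewrite (le_trans a0 au) (le_lt_trans ub b1).
  have le : 6 * enorm (X (H0 (ray z t)) - X (H0 (ray z s))) <= K * (t - s).
    rewrite GX ?(le_trans as_ st)// GX ?(le_trans st tb)// /K -mulrA ler_pM2l//.
    by rewrite (le_trans (hL _ _))// ray_dist ger0_norm ?subr_ge0// -mulrA [_ * (t - s)]mulrC.
  have weaken p q c c' : c <= c' -> short_path p q c -> short_path p q c'.
    by move=> cc [l h1 h2]; exists l => //; rewrite (le_trans h2)// lee_fin.
  split; first by apply: weaken le _; exact: short.
  by apply: weaken le _; rewrite enormB; exact: short.
Qed.

(** By [star_lift_short] the values at the times [1 - 1/(i+1)] form a Cauchy sequence;
    [distance_nbhs] turns its limit into a topological one. *)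
Lemma star_lift_limit G H0 z : star_lift G H0 ->
  (forall s, 0 <= s < 1 -> G (ray z s)) ->
  exists2 p, X p = h z & forall O, nbhs p O -> exists N, forall i, (N <= i)%N ->
    O (H0 (ray z (1 - i.+1%:R^-1))).
Proof.
move=> sG hz; have [_ _ _ _ cG] := sG.
pose t (i : nat) : R := 1 - i.+1%:R^-1.
pose u i := H0 (ray z (t i)).
have t0 i : 0 <= t i by rewrite subr_ge0 invf_le1 ?ltr0n// ler1n.
have t1 i : t i < 1 by rewrite gtrBl invr_gt0 ltr0n.
have tm i j : (i <= j)%N -> t i <= t j.
  by move=> ij; rewrite lerD2l lerN2 lef_pV2 ?posrE ?ltr0n// ler_nat ltnS.
have td i j N : (N <= i)%N -> (i <= j)%N -> t j - t i <= N.+1%:R^-1.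
  move=> Ni ij; rewrite /t; apply: (@le_trans _ _ (i.+1%:R^-1)).
    by rewrite opprB addrC subrKA; rewrite gerBl invr_ge0 ler0n.
  by rewrite lef_pV2 ?posrE ?ltr0n// ler_nat ltnS.
pose K := 6 * (L * `|z - x0|) + 1.
have K0 : 0 < K by rewrite ltr_wpDl// mulr_ge0// mulr_ge0// ltW.
have small (e : R) : 0 < e -> exists N, N.+1%:R^-1 < e :> R.
  by move=> e0; exists (Num.truncn e^-1); rewrite invf_plt ?posrE// ?truncnS_gt.
have [|p hp] := @cM u.
  move=> e e0; have [N hN] := small (e / K) (divr_gt0 e0 K0).
  exists N.
  have key i j : (N <= i)%N -> (i <= j)%N -> (6 * (L * `|z - x0|)) * (t j - t i) < e.
    move=> Ni ij; apply: (@le_lt_trans _ _ (K * N.+1%:R^-1)).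
      rewrite ler_pM ?mulr_ge0 ?subr_ge0 ?tm//; first by rewrite ltW.
        by rewrite /K lerDl.
      exact: td.
    by rewrite mulrC -ltr_pdivlMr.
  move=> i j Ni Nj; have [ij|/ltnW ji] := leqP i j.
    have [h1 _] := star_lift_short sG hz (t0 i) (tm _ _ ij) (t1 j).
    by rewrite (le_lt_trans (short_path_dist h1))// lte_fin key.
  have [_ h1] := star_lift_short sG hz (t0 j) (tm _ _ ji) (t1 i).
  by rewrite (le_lt_trans (short_path_dist h1))// lte_fin key.
have lim O : nbhs p O -> exists N, forall i, (N <= i)%N -> O (u i).
  move=> /distance_nbhs[e e0 he]; have [N hN] := hp e e0.
  by exists N => i /hN/he.
exists p => //.
(* [h (ray z (t i)) = X (u i)] tends both to [X p] and to [h z]. *)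
apply/eqP; rewrite -subr_eq0 -enorm_eq0 eq_le enorm_ge0 andbT.
apply/ler_addgt0Pl => e e0; rewrite addr0.
have e20 : 0 < e / 2 by rewrite divr_gt0.
have nO : nbhs p [set q | enorm (X p - X q) < e / 2].
  have c : {for p, continuous (fun q => enorm (X p - X q))}.
    apply: (@continuous_comp _ _ _ (fun q => X p - X q) (@enorm R n.+1));
      last exact: continuous_enorm.
    by apply: continuousB; [exact: cst_continuous|exact: immersion_continuous].
  by have /cvgr_lt := c; apply; rewrite subrr enorm0.
have [N hN] := lim _ nO.
have [N' hN'] := small (e / 2 / K) (divr_gt0 e20 K0).
pose i := maxn N N'.
have := hN i (leq_maxl _ _); rewrite /= (cG _ _).2; last by apply: hz; rewrite t0 t1.
move=> h1.
have h2 : enorm (h (ray z (t i)) - h z) < e / 2.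
  rewrite (le_lt_trans (hL _ _))// -[z in _ - z]ray1 ray_dist.
  apply: (@le_lt_trans _ _ (K * N'.+1%:R^-1)); last by rewrite mulrC -ltr_pdivlMr.
  rewrite mulrCA [K * _]mulrC; apply: ler_pM => //.
  - by rewrite mulr_ge0// ltW.
  - rewrite /t addrAC subrr add0r normrN ger0_norm ?invr_ge0//.
    by rewrite lef_pV2 ?posrE ?ltr0n// ler_nat ltnS leq_maxr.
  - rewrite /K; have : 0 <= L * `|z - x0| by rewrite mulr_ge0// ltW.
    move: (L * _) => w w0; lra.
rewrite [leRHS]splitr (le_trans _ (ltW (ltrD h1 h2)))//.
by rewrite (le_trans _ (enormD _ _))// subrKA.
Qed.

(* The lift of the ray converges by completeness; a local section of [X] at the
   limit extends it over a small ball about [z], which is glued to [H0]. *)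
Lemma star_lift_extend G H0 z : star_lift G H0 ->
  (forall s, 0 <= s < 1 -> G (ray z s)) -> exists U H, star_lift U H /\ U z.
Proof.
move=> sG hz; have [oG Gx0 H00 stG cG] := sG.
have [p Xp lim] := star_lift_limit sG hz.
have [W [e [tau [[oW Wp] e0 inj _ htau]]]] := local_section iX r0 Xr p.
pose B := [set y | `|y - z| < e / L].
have Be y : B y -> enorm (h y - X p) < e.
  by move=> yd; rewrite Xp (le_lt_trans (hL _ _))// mulrC -ltr_pdivlMr.
have eL : 0 < e / L by rewrite divr_gt0.
have oB : open B by exact: dist_ball_open.
pose H2 := tau \o h.
have H2P y : B y -> [/\ W (H2 y), X (H2 y) = h y & {for y, continuous H2}].
  move=> By; have [W1 X1 h1] := htau _ (hr y) (Be _ By); split=> //.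
  by apply: section_continuous (Be _ By) h1 => //; exact: lipschitz_continuous.
(* A time close enough to 1 for the ray to be in [B] and its lift in [W]; injectivity on [W] makes
   the two lifts agree there. *)
have [s [/andP[s0 s1] Bs Ws]] : exists s : R, [/\ 0 <= s < 1, B (ray z s) & W (H0 (ray z s))].
  have [N hN] := lim W (open_nbhs_nbhs (conj oW Wp)).
  have nB : nbhs (1 : R) (ray z @^-1` B).
    apply: (@ray_continuous z 1); rewrite ray1; apply: open_nbhs_nbhs; split=> //.
    by rewrite /B /= subrr normr0.
  have [d d0 hd] := (nbhs_distP _ _).1 nB.
  pose i := maxn N (Num.truncn d^-1).
  exists (1 - i.+1%:R^-1); split.
  - by rewrite subr_ge0 invf_le1 ?ltr0n// ler1n /= gtrBl invr_gt0 ltr0n.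
  - apply: hd; rewrite addrAC subrr add0r normrN ger0_norm ?invr_ge0//.
    rewrite invf_plt ?posrE// (lt_le_trans (truncnS_gt _))// ler_nat ltnS.
    exact: leq_maxr.
  - by apply: hN; exact: leq_maxl.
have s01 : 0 <= s <= 1 by rewrite s0 ltW.
have Gs : G (ray z s) by apply: hz; rewrite s0.
pose V := [set y | [/\ G y, B y & H0 y = H2 y]].
have Vs : V (ray z s).
  split=> //; have [W2 X2 _] := H2P _ Bs.
  by apply: inj => //; rewrite X2 (cG _ Gs).2.
have oV : open V.
  rewrite openE => y [Gy By e12].
  have [c0 X0] := cG _ Gy; have [_ X2 c2] := H2P _ By.
  have [W' [oW' W'y inj' _]] := local_isometry_chart iX (H0 y).
  have n1 : \forall w \near y, W' (H0 w) by apply: c0; exact: open_nbhs_nbhs.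
  have n2 : \forall w \near y, W' (H2 w) by apply: c2; rewrite -e12; exact: open_nbhs_nbhs.
  have n3 : \forall w \near y, G w /\ B w.
    by apply: filterI; exact: open_nbhs_nbhs.
  move: n1 n2 n3; apply: filterS3 => w W1 W2 [Gw Bw]; split=> //.
  by have [_ X2w _] := H2P _ Bw; apply: inj' => //; rewrite X2w (cG _ Gw).2.
(* The points of [B] whose ray meets the agreement set [V]. Adding all of [B] to [G] could break
   star-shapedness or produce conflicting values; adding [C] does neither. *)
pose C := [set y | B y /\ exists2 t : R, 0 <= t <= 1 & V (ray y t)].
have oC : open C.
  rewrite openE => y [By [t t01 Vt]].
  have n1 : \forall w \near y, V (ray w t).
    have [d d0 hd] := (nbhs_distP _ _).1 (open_nbhs_nbhs (conj oV Vt)).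
    apply/nbhs_distP; exists d => // w wy; apply: hd.
    have -> : ray w t - ray y t = t *: (w - y) by apply/rowP => i; rewrite !mxE; ring.
    move: t01 => /andP[t0 t1]; rewrite normrZ ger0_norm// (le_lt_trans _ wy)//.
    by rewrite ler_piMl.
  have n2 : \forall w \near y, B w by exact: open_nbhs_nbhs.
  by move: n1 n2; apply: filterS2 => w Vw Bw; split=> //; exists t.
(* The segment from [ray y t] to [y] stays in [G], which is star-shaped, and in [B], which is
   convex, so agreement propagates to [y]. *)
have CG y : C y -> G y -> H0 y = H2 y.
  move=> [By [t t01 [Gt Bt et]]] Gy.
  have sub (u : R) : 0 <= u <= 1 -> ray y t + u *: (y - ray y t) = ray y (t + u * (1 - t)).
    by move=> _; rewrite /ray; apply/rowP => i; rewrite !mxE; ring.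
  have sub01 (u : R) : 0 <= u <= 1 -> 0 <= t + u * (1 - t) <= 1.
    move: t01 => /andP[t0 t1] /andP[u0 u1]; apply/andP; split;
      first by rewrite addr_ge0// mulr_ge0// subr_ge0.
    by rewrite -[leRHS](subrKC t) lerD2l ler_piMl// subr_ge0.
  have Gu (u : R) : 0 <= u <= 1 -> G (ray y t + u *: (y - ray y t)).
    by move=> u01; rewrite sub//; apply: stG => //; exact: sub01.
  have Bu (u : R) : 0 <= u <= 1 -> B (ray y t + u *: (y - ray y t)).
    by move=> u01; exact: ball_convex.
  apply: (@lift_unique_segment _ H0 H2 (ray y t) y) => //.
  - by move=> u /Gu/cG[].
  - by move=> u /Bu/H2P[].
  - by move=> u u01; have [_ -> _] := H2P _ (Bu _ u01); rewrite (cG _ (Gu _ u01)).2.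
pose H' y := if pselect (G y) then H0 y else H2 y.
have H'G y : G y -> H' y = H0 y by rewrite /H'; case: pselect.
have H'C y : C y -> H' y = H2 y by move=> Cy; rewrite /H'; case: pselect => // Gy; exact: CG.
exists (G `|` C), H'; split; last first.
  by right; split; [rewrite /B /= subrr normr0|exists s].
split.
- exact: openU.
- by left.
- by rewrite H'G.
- move=> y u [Gy|[By [t t01 Vt]]] u01; first by left; exact: stG.
  (* Before time [t] the ray lies in [G], by star-shapedness at [ray y t]. From [t] on it lies in
     [B] by convexity and has met [V], so it lies in [C]. *)
  have [tu|ut] := leP t u; last first.
    left; have t0 : 0 < t by case/andP: u01 => u0 _; exact: le_lt_trans ut.
    have -> : ray y u = ray (ray y t) (u / t) by rewrite rayM divfK ?gt_eqF.
    apply: stG; first by case: Vt.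
    by case/andP: u01 => u0 _; apply: frac01 => //; exact: ltW.
  right; split.
    have [|t1] := eqVneq t 1.
      move=> tt; have -> : u = 1 by apply/eqP; rewrite eq_le -{2}tt tu andbT; case/andP: u01.
      by rewrite ray1.
    have Bt : B (ray y t) by case: Vt.
    have t1' : 0 < 1 - t by rewrite subr_gt0 lt_neqAle t1; case/andP: t01.
    have -> : ray y u = ray y t + ((u - t) / (1 - t)) *: (y - ray y t).
      rewrite /ray; apply/rowP => i; rewrite !mxE; field; rewrite gt_eqF//.
    apply: ball_convex => //; apply: frac01 => //; first by rewrite subr_ge0.
    by rewrite lerD2r; case/andP: u01.
  case: (eqVneq u 0) => [u0|un0].
    exists 1; first by rewrite ler01 lexx.
    by rewrite rayM mul1r; have <- : t = u by apply/eqP; rewrite eq_le tu u0; case/andP: t01.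
  have ugt0 : 0 < u by rewrite lt_def un0; case/andP: u01.
  exists (t / u); last by rewrite rayM divfK.
  by case/andP: t01 => t0 _; exact: frac01.
- move=> y [Gy|Cy].
    have [c0 X0] := cG _ Gy; rewrite H'G//; split=> //.
    apply: continuous_at_near c0.
    by apply: filterS (open_nbhs_nbhs (conj oG Gy)) => w Gw; rewrite H'G.
  have [_ X2 c2] := H2P _ Cy.1; rewrite H'C//; split=> //.
  apply: continuous_at_near c2.
  by apply: filterS (open_nbhs_nbhs (conj oC Cy)) => w Cw; rewrite H'C.
Qed.

(** Interval induction on each ray for the maximal domain [G]: openness carries [G] past its points,
    and a point approached by [G] from the left belongs to it by [star_lift_extend] and
    maximality. *)
Lemma global_lift : exists H : 'rV[R]_k -> M,
  [/\ continuous H, forall x, X (H x) = h x & H x0 = p0].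
Proof.
have [G [H0 [sG maxG]]] := maximal_star_lift; have [oG Gx0 H00 stG cG] := sG.
have GT z : G z.
  rewrite -(ray1 z); apply: (@interval_induction R (fun s t => G (ray z s) ->
    G (ray z t)) 0 1 ler01).
  - by move=> s t u _ _ _ _ h1 h2 /h1/h2.
  - move=> x /andP[x0_ x1]; have [Gx|nGx] := pselect (G (ray z x)).
      have n1 : \forall s \near x, G (ray z s).
        by apply: ray_continuous; exact: open_nbhs_nbhs.
      have [d d0 hd] := (nbhs_distP _ _).1 n1.
      by exists d => // s t _ _ xt _ _ td _; apply: hd; rewrite ger0_norm// subr_ge0.
    have [hall|/existsNP[d /not_implyP[d0 hd]]] :=
      pselect (forall d, 0 < d -> exists s, [/\ s <= x, x - s < d & G (ray z s)]).
      case: nGx; have [|U [H [sU Ux]]] := @star_lift_extend G H0 (ray z x) sG;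
        last exact: maxG sU _ Ux.
      move=> s /andP[s0 s1]; rewrite rayM.
      have [xz|xn0] := eqVneq x 0; first by rewrite xz mulr0 ray0.
      have xgt0 : 0 < x by rewrite lt_def xn0.
      have [|t [tx td Gt]] := hall ((1 - s) * x); first by rewrite mulr_gt0// subr_gt0.
      have st : s * x < t by move: td; rewrite mulrBl mul1r; lra.
      have tgt0 : 0 < t by rewrite (le_lt_trans _ st)// mulr_ge0.
      have -> : ray z (s * x) = ray (ray z t) (s * x / t) by rewrite rayM divfK ?gt_eqF.
      by apply: stG => //; apply: frac01 => //; [rewrite mulr_ge0|exact: ltW].
    (* The ray has no point of [G] just before [x], and the implication is vacuous. *)
    exists d => // s t s0 sx xt t1 sd _ Gs; case: hd.
    by exists s.
  - by rewrite ray0.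
exists H0; split=> // [x|x]; first by case: (cG _ (GT x)).
by case: (cG _ (GT x)).
Qed.

End LiftingMap.
End Lifts.

(** * Stereographic coordinates *)

Section Stereographic.
Context {R : realType} {n : nat}.
Variable r : R.
Hypothesis r0 : 0 < r.

(* Inverse stereographic projection of the sphere of radius [r] from its pole
   of height [b * r], where [b] is a sign. *)
Definition stereo_inv (b : R) (x : 'rV[R]_n) : 'rV[R]_n.+1 :=
  \row_k (if unlift ord0 k is Some j then 2 * r / (1 + dot x x) * x 0 j
          else b * r * (dot x x - 1) / (1 + dot x x)).

Definition stereo (b : R) (y : 'rV[R]_n.+1) : 'rV[R]_n :=
  (r - b * y 0 ord0)^-1 *: \row_j y 0 (lift ord0 j).

Lemma stereo_inv_head b x :
  stereo_inv b x 0 ord0 = b * r * (dot x x - 1) / (1 + dot x x).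
Proof. by rewrite mxE unlift_none. Qed.

Lemma stereo_inv_tail b x j :
  stereo_inv b x 0 (lift ord0 j) = 2 * r / (1 + dot x x) * x 0 j.
Proof. by rewrite mxE liftK. Qed.

Lemma dot_recl (u v : 'rV[R]_n.+1) :
  dot u v = u 0 ord0 * v 0 ord0 + \sum_(j < n) u 0 (lift ord0 j) * v 0 (lift ord0 j).
Proof. by rewrite /dot big_ord_recl. Qed.

Let den (x : 'rV[R]_n) : 0 < 1 + dot x x.
Proof. by rewrite ltr_wpDr ?dot_ge0. Qed.

Lemma dot_stereo_inv b x y : b * b = 1 -> dot (stereo_inv b x) (stereo_inv b y) =
  r ^+ 2 * ((dot x x - 1) * (dot y y - 1) + 4 * dot x y) / ((1 + dot x x) * (1 + dot y y)).
Proof.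
move=> b1; rewrite dot_recl !stereo_inv_head.
have -> : \sum_(j < n) stereo_inv b x 0 (lift ord0 j) * stereo_inv b y 0 (lift ord0 j) =
    2 * r / (1 + dot x x) * (2 * r / (1 + dot y y)) * dot x y.
  rewrite /dot mulr_sumr; apply: eq_bigr => j _; rewrite !stereo_inv_tail.
  by rewrite mulrACA.
have dx := den x; have dy := den y; move: (dot x x) (dot y y) (dot x y) dx dy => p q s dp dq.
have -> : b * r * (p - 1) / (1 + p) * (b * r * (q - 1) / (1 + q)) =
   (b * b) * (r ^+ 2 * (p - 1) * (q - 1) / ((1 + p) * (1 + q))).
  by field; rewrite !gt_eqF.
by rewrite b1; field; rewrite !gt_eqF.
Qed.

Lemma enorm_stereo_inv b x : b * b = 1 -> enorm (stereo_inv b x) = r.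
Proof.
move=> b1; rewrite /enorm dot_stereo_inv//.
have dx := den x; move: (dot x x) dx => p dp.
have -> : r ^+ 2 * ((p - 1) * (p - 1) + 4 * p) / ((1 + p) * (1 + p)) = r ^+ 2.
  by field; rewrite gt_eqF.
by rewrite sqrtr_sqr gtr0_norm.
Qed.

(** The chordal form of conformality; injectivity and the Lipschitz bound are read off from it. *)
Lemma sqr_dist_stereo_inv b x y : b * b = 1 ->
  let u := stereo_inv b x - stereo_inv b y in
  dot u u = 4 * r ^+ 2 * dot (x - y) (x - y) / ((1 + dot x x) * (1 + dot y y)).
Proof.
move=> b1 /=; rewrite !(dotDl, dotDr, dotNl, dotNr) !dot_stereo_inv// [dot y x]dotC.
have dx := den x; have dy := den y; move: (dot x x) (dot y y) (dot x y) dx dy => p q s dp dq.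
by field; rewrite !gt_eqF.
Qed.

Lemma stereo_inv_inj b : b * b = 1 -> injective (stereo_inv b).
Proof.
move=> b1 x y e; have := sqr_dist_stereo_inv x y b1; rewrite e /= subrr dot0l.
have r4 : 0 < 4 * r ^+ 2 by rewrite mulr_gt0// exprn_gt0.
move/esym/eqP; rewrite mulf_eq0 invr_eq0 (gt_eqF (mulr_gt0 (den _) (den _))) orbF.
by rewrite mulf_eq0 (gt_eqF r4) dot_eq0 subr_eq0 => /eqP.
Qed.

Lemma stereo_inv_lipschitz b x y : b * b = 1 ->
  enorm (stereo_inv b x - stereo_inv b y) <= (2 * r * n%:R + 1) * `|x - y|.
Proof.
(* The Euclidean constant is [2 r], both denominators being at least 1. The factor [n] accounts for
   the sup norm, and the added 1 makes the constant positive for every [n]. *)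
move=> b1; apply: (@le_trans _ _ (2 * r * enorm (x - y))).
  rewrite -(@ler_pXn2r _ 2) ?nnegrE ?mulr_ge0 ?enorm_ge0 ?(ltW r0)//.
  rewrite exprMn !sqr_enorm sqr_dist_stereo_inv// ler_pdivrMr ?mulr_gt0//.
  have := dot_ge0 (x - y); have := dot_ge0 x; have := dot_ge0 y.
  move: (dot x x) (dot y y) (dot (x - y) (x - y)) => p q s q0 p0 s0.
  have -> : (2 * r) ^+ 2 * s = 4 * r ^+ 2 * s by ring.
  rewrite ler_peMr ?mulr_ge0 ?sqr_ge0 ?(ltW r0)//.
  have := mulr_ge0 p0 q0; lra.
rewrite [leRHS]mulrDl mul1r -[2 * r * n%:R * _]mulrA ler_wpDr//.
by rewrite ler_wpM2l ?enorm_le_norm// mulr_ge0// ltW.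
Qed.

Lemma stereo_inv_not_pole b x : b * b = 1 -> stereo_inv b x 0 ord0 != b * r.
Proof.
move=> b1; rewrite stereo_inv_head -subr_eq0; apply/eqP.
have bn0 : b != 0 by apply/eqP => b0; move: b1; rewrite b0 mul0r => /esym/eqP; rewrite oner_eq0.
have dx := den x; move: (dot x x) dx => p dp.
have -> : b * r * (p - 1) / (1 + p) - b * r = - (2 * (b * r) / (1 + p)).
  by field; rewrite gt_eqF.
move/eqP; rewrite oppr_eq0 !mulf_eq0 invr_eq0 (gt_eqF dp) (negPf bn0) (gt_eqF r0).
by rewrite pnatr_eq0.
Qed.

Let pole_den b (y : 'rV[R]_n.+1) : b * b = 1 -> y 0 ord0 != b * r -> r - b * y 0 ord0 != 0.
Proof.
move=> b1; apply: contra; rewrite subr_eq0 => /eqP ->.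
by rewrite mulrA b1 mul1r.
Qed.

Lemma stereoK b y : b * b = 1 -> enorm y = r -> y 0 ord0 != b * r ->
  stereo_inv b (stereo b y) = y.
Proof.
move=> b1 yr yb; have d0 := pole_den b1 yb.
have := sqr_enorm y; rewrite yr dot_recl => e.
set t := \sum_(j < n) _ in e.
have et : t = (r - b * y 0 ord0) * (r + b * y 0 ord0).
  have -> : (r - b * y 0 ord0) * (r + b * y 0 ord0) = r ^+ 2 - (b * b) * y 0 ord0 ^+ 2 by ring.
  by rewrite b1 e; ring.
have ed : dot (stereo b y) (stereo b y) = (r + b * y 0 ord0) / (r - b * y 0 ord0).
  rewrite /stereo dotZl dotZr.
  have -> : dot (\row_j y 0 (lift ord0 j)) (\row_j y 0 (lift ord0 j)) = t.
    by apply: eq_bigr => j _; rewrite !mxE.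
  by rewrite et; field.
have e1 : 1 + dot (stereo b y) (stereo b y) = 2 * r / (r - b * y 0 ord0).
  by rewrite ed; field.
have e2 : dot (stereo b y) (stereo b y) - 1 = 2 * (b * y 0 ord0) / (r - b * y 0 ord0).
  by rewrite ed; field.
apply/rowP => k; case: (unliftP ord0 k) => [j ->|->].
  rewrite stereo_inv_tail e1 !mxE; by field; rewrite d0 (gt_eqF r0).
rewrite stereo_inv_head e1 e2.
have -> : b * r * (2 * (b * y 0 ord0) / (r - b * y 0 ord0)) / (2 * r / (r - b * y 0 ord0)) =
  (b * b) * y 0 ord0 by field; rewrite d0 (gt_eqF r0).
by rewrite b1 mul1r.
Qed.

Lemma stereo_invK b x : b * b = 1 -> stereo b (stereo_inv b x) = x.
Proof.
move=> b1; apply: (stereo_inv_inj b1).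
by rewrite stereoK// ?enorm_stereo_inv// stereo_inv_not_pole.
Qed.

Lemma stereo_continuous b (y : 'rV[R]_n.+1) : b * b = 1 -> y 0 ord0 != b * r ->
  {for y, continuous (stereo b : 'rV[R]_n.+1 -> 'rV[R]_n)}.
Proof.
move=> b1 yb; have d0 := pole_den b1 yb.
have cc k : {for y, continuous (fun z : 'rV[R]_n.+1 => z 0 k)} by exact: coord_continuous.
have c1 : {for y, continuous (fun z : 'rV[R]_n.+1 => \row_j z 0 (lift ord0 j) : 'rV[R]_n)}.
  have -> : (fun z : 'rV[R]_n.+1 => \row_j z 0 (lift ord0 j)) =
      fun z => \sum_(j < n) z 0 (lift ord0 j) *: (delta_mx 0 j : 'rV[R]_n).
    by apply/funext => z; rewrite [LHS]row_sum_delta; apply: eq_bigr => j _; rewrite mxE.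
  apply: continuous_at_sum => j.
  by apply: (continuousZ (cc _)); exact: cst_continuous.
have c2 : {for y, continuous (fun z : 'rV[R]_n.+1 => r - b * z 0 ord0)}.
  apply: continuousB; first exact: cst_continuous.
  by apply: continuousM; [exact: cst_continuous|exact: cc].
have c3 : {for y, continuous (fun z : 'rV[R]_n.+1 => (r - b * z 0 ord0)^-1)}.
  exact: continuousV.
exact: (continuousZ c3 c1).
Qed.

(** Inversion in the unit sphere: the change of coordinates between the two poles. Its value at 0 is
    0. *)
Definition inversion (x : 'rV[R]_n) : 'rV[R]_n := (dot x x)^-1 *: x.

Lemma dot_inversion x : dot (inversion x) (inversion x) = (dot x x)^-1.
Proof.
rewrite /inversion dotZl dotZr; have [->|x0] := eqVneq (dot x x) 0.
  by rewrite invr0 !mul0r.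
by rewrite mulVf ?mulr1.
Qed.

Lemma inversion_eq0 x : (inversion x == 0) = (x == 0).
Proof. by rewrite -!dot_eq0 dot_inversion invr_eq0. Qed.

Lemma inversionK x : x != 0 -> inversion (inversion x) = x.
Proof.
move=> x0; rewrite {1}/inversion dot_inversion invrK /inversion scalerA mulfV ?scale1r//.
by rewrite dot_eq0.
Qed.

Lemma stereo_inv_inversion b x : x != 0 -> stereo_inv b (inversion x) = stereo_inv (- b) x.
Proof.
rewrite -dot_eq0 => x0; have dx := den x.
apply/rowP => k; case: (unliftP ord0 k) => [j ->|->].
  rewrite !stereo_inv_tail dot_inversion mxE.
  by field; rewrite x0 gt_eqF//= addrC gt_eqF.
rewrite !stereo_inv_head dot_inversion.
by field; rewrite x0 gt_eqF//= addrC gt_eqF.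
Qed.

Lemma inversion_continuous (x : 'rV[R]_n) : x != 0 ->
  {for x, continuous (inversion : 'rV[R]_n -> 'rV[R]_n)}.
Proof.
move=> x0; have c1 : {for x, continuous (fun z : 'rV[R]_n => dot z z)}.
  by apply: differentiable_continuous; apply: differentiable_dot.
have c2 : {for x, continuous (fun z : 'rV[R]_n => (dot z z)^-1)}.
  by apply: continuousV => //; rewrite dot_eq0.
have c3 : {for x, continuous (id : 'rV[R]_n -> 'rV[R]_n)} by exact: cvg_id.
exact: (continuousZ c2 c3).
Qed.

End Stereographic.

(** * The two lifts cover the manifold, and the immersion is an embedding *)

Section SphereCovering.
Context {R : realType} {n : nat} {M : riemannianManifold R n}.
Variables (X : M -> 'rV[R]_n.+1) (r : R).
Hypothesis n2 : (2 <= n)%N.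
Hypothesis conn : connected_manifold M.
Hypothesis cM : complete_manifold M.
Hypothesis iX : isometric_immersion X.
Hypothesis r0 : 0 < r.
Hypothesis Xr : forall p, enorm (X p) = r.

Let i0 : 'I_n := Ordinal (ltn_trans (ltnSn 0) n2).
Let i1 : 'I_n := Ordinal n2.
Let u0 : 'rV[R]_n := delta_mx 0 i0.
Let u1 : 'rV[R]_n := delta_mx 0 i1.

(** Follow the segment from [u0] to [x]. If it passes through 0 then [x] is a multiple of [u0], and
    a detour through the independent vector [u1] avoids 0. *)
Lemma lifts_agree_off_origin (c1 c2 : 'rV[R]_n -> M) :
  (forall x, x != 0 -> {for x, continuous c1}) ->
  (forall x, x != 0 -> {for x, continuous c2}) ->
  (forall x, x != 0 -> X (c1 x) = X (c2 x)) -> c1 u0 = c2 u0 ->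
  forall x, x != 0 -> c1 x = c2 x.
Proof.
move=> k1 k2 kX e x x0.
have seg a c : (forall s : R, 0 <= s <= 1 -> a + s *: (c - a) != 0) -> c1 a = c2 a -> c1 c = c2 c.
  move=> nz; apply: (lift_unique_segment iX) => s /nz; [exact: k1|exact: k2|exact: kX].
have i01 : (i0 == i1) = false by [].
have [h|/existsNP[s /not_implyP[s01 /negP/negPn/eqP hs]]] :=
  pselect (forall s : R, 0 <= s <= 1 -> u0 + s *: (x - u0) != 0).
  exact: seg h e.
have e1 : c1 u1 = c2 u1.
  apply: (seg u0 u1) => // t _; apply/eqP => /rowP h.
  have := h i0; have := h i1; rewrite !mxE !eqxx i01 eq_sym i01 /= => h1 h0; clear e; lra.
apply: (seg u1 x) => // t _; apply/eqP => /rowP h.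
(* The coordinate [i1] of [x] is 0, so a zero of the segment from [u1] to [x] would have [t = 1],
   that is [x = 0]. *)
clear e e1; have h0 := ((rowP _ _).2 hs) i0; have h1 := ((rowP _ _).2 hs) i1; have h2 := h i1.
move: h0 h1 h2; rewrite !mxE !eqxx eq_sym i01 /= => h0 h1 h2.
have s0 : s != 0 by apply/eqP => s0; move: h0; rewrite s0; lra.
have x1 : x 0 i1 = 0.
  by move/eqP: h1; rewrite subr0 add0r mulf_eq0 (negPf s0) => /eqP.
have t1 : t = 1 by move: h2; rewrite x1; lra.
move: x0; rewrite (_ : x = 0) ?eqxx//; apply/rowP => i.
by have := h i; rewrite t1 !mxE; lra.
Qed.

(** Near [H x] the map [H o stereo o X] takes values in the injectivity domain [W] and does not
    change the image under [X], so it is the identity. *)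
Lemma lift_range_open b (H : 'rV[R]_n -> M) : b * b = 1 -> continuous H ->
  (forall x, X (H x) = stereo_inv r b x) -> open (range H).
Proof.
move=> b1 cH XH; rewrite openE => _ [x _ <-].
have nb : X (H x) 0 ord0 != b * r by rewrite XH stereo_inv_not_pole.
have [W [oW Wx inj _]] := local_isometry_chart iX (H x).
have cX := @immersion_continuous _ _ _ _ X iX.
have c1 : {for H x, continuous (H \o (stereo r b \o X))}.
  apply: continuous_comp; last exact: cH.
  by apply: continuous_comp; [exact: cX|exact: stereo_continuous].
have n1 : \forall q \near H x, W (H (stereo r b (X q))).
  by apply: c1; rewrite /= XH stereo_invK//; exact: open_nbhs_nbhs.
have nW : \forall q \near H x, W q by exact: open_nbhs_nbhs.
have nP : \forall q \near H x, X q 0 ord0 - b * r != 0.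
  have c : {for H x, continuous (fun q => X q 0 ord0 - b * r)}.
    apply: continuousB; last exact: cst_continuous.
    by apply: (@continuous_comp _ _ _ X (fun z : 'rV[R]_n.+1 => z 0 ord0));
      [exact: cX|exact: coord_continuous].
  by apply: (cvgr_neq0 _ c); rewrite subr_eq0.
move: n1 nW nP; apply: filterS3 => q W1 W2; rewrite subr_eq0 => qb.
exists (stereo r b (X q)) => //; apply: inj => //.
by rewrite XH stereoK.
Qed.

Lemma isometric_to_sphere : isometric_to M (@euclidean_sphere R n r).
Proof.
have [[p0 _] cT] := conn.
have cX := @immersion_continuous _ _ _ _ X iX.
(* The pole is chosen away from [X p0], so that the first lift has a starting point. *)
have [b b1 pb] : exists2 b, b * b = 1 & X p0 0 ord0 != b * r.
  have [e|ne] := eqVneq (X p0 0 ord0) (1 * r); last by exists 1; rewrite ?mulr1.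
  exists (-1); first by rewrite mulrNN mulr1.
  by rewrite e -subr_eq0 mul1r mulN1r opprK -mulr2n mulrn_eq0 (gt_eqF r0).
have b1' : - b * - b = 1 by rewrite mulrNN.
have L0 : 0 < 2 * r * n%:R + 1 by rewrite ltr_wpDl// !mulr_ge0// ltW.
have lip c : c * c = 1 -> forall x y : 'rV[R]_n, enorm (stereo_inv r c x - stereo_inv r c y) <=
    (2 * r * n%:R + 1) * `|x - y|.
  by move=> c1 x y; exact: stereo_inv_lipschitz.
have [H [cH XH _]] := global_lift iX r0 Xr cM L0 (fun x => @enorm_stereo_inv R n r r0 b x b1)
  (lip b b1) (esym (stereoK r0 b1 (Xr p0) pb)).
have du0 : dot u0 u0 = 1.
  rewrite /dot (bigD1 i0)//= big1 ?addr0 => [|i ii0]; first by rewrite mxE !eqxx mulr1.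
  by rewrite mxE (negPf ii0) andbF mul0r.
have u00 : u0 != 0 by rewrite -dot_eq0 du0 oner_eq0.
(* The second lift starts at [u0], a fixed point of the inversion, where the two lifts can be made
   to coincide. *)
have iu0 : inversion u0 = u0 by rewrite /inversion du0 invr1 scale1r.
have XHu0 : X (H u0) = stereo_inv r (- b) u0.
  by rewrite XH -{1}iu0 stereo_inv_inversion.
have [H' [cH' XH' H'u0]] := global_lift iX r0 Xr cM L0
  (fun x => @enorm_stereo_inv R n r r0 (- b) x b1') (lip (- b) b1') XHu0.
have agree x : x != 0 -> H' x = H (inversion x).
  apply: (@lifts_agree_off_origin H' (H \o inversion)).
  - by move=> y _; exact: cH'.
  - by move=> y y0; apply: continuous_comp; [exact: inversion_continuous|exact: cH].
  - by move=> y y0; rewrite /= XH XH' stereo_inv_inversion.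
  - by rewrite /= iu0.
(* The inversion exchanges the inside and the outside of the unit ball, so the images of the closed
   ball under the two lifts already fill [A]. *)
pose B := [set x : 'rV[R]_n | dot x x <= 1].
have cB : compact B.
  apply: bounded_closed_compact.
    exists 1; split=> // N N1 x Bx; apply: le_trans (ltW N1); apply: le_trans (norm_le_enorm _) _.
    by rewrite -(@ler_pXn2r _ 2) ?nnegrE ?enorm_ge0// sqr_enorm expr1n.
  have c : continuous (fun z : 'rV[R]_n => dot z z).
    by move=> z; apply: differentiable_continuous; apply: differentiable_dot.
  exact: (@closed_comp _ _ (fun z : 'rV[R]_n => dot z z) [set t | t <= 1] (fun z _ => c z)
    (@closed_le R 1)).
pose A := range H `|` range H'.
have AE : A = H @` B `|` H' @` B.
  apply/seteqP; split=> q; last by move=> [[x _ <-]|[x _ <-]]; [left|right]; exists x.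
  have big (x : 'rV[R]_n) : ~ B x -> x != 0 /\ B (inversion x).
    move=> /negP; rewrite /B /= -ltNge => x1; split.
      by rewrite -dot_eq0 gt_eqF// (lt_trans ltr01).
    by rewrite dot_inversion invf_le1 ?ltW// (lt_trans ltr01).
  move=> [[x _ <-]|[x _ <-]]; have [Bx|/big[x0 Bx]] := pselect (B x).
  - by left; exists x.
  - by right; exists (inversion x) => //; rewrite agree ?inversion_eq0// inversionK.
  - by right; exists x.
  - by left; exists (inversion x) => //; rewrite agree.
have cA : compact A.
  by rewrite AE; apply: compactU; apply: continuous_compact => //; exact: continuous_subspaceT.
have AT : A = setT.
  apply: cT.
  - by exists (H 0); left; exists 0.
  - exists A; last by rewrite setTI.
    by apply: openU; [exact: lift_range_open XH|exact: lift_range_open XH'].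
  - exists A; last by rewrite setTI.
    by apply: compact_closed => //; exact: man_hausdorff.
(* By [agree], the second lift contributes only [H' 0], which lies over the pole missed by the
   first; injectivity of [X] reduces to that of [stereo_inv]. *)
have cover q : (exists x, q = H x) \/ q = H' 0.
  have : A q by rewrite AT.
  move=> [[x _ <-]|[x _ <-]]; first by left; exists x.
  have [->|x0] := eqVneq x 0; first by right.
  by left; exists (inversion x); rewrite agree.
have XH'0 : X (H' 0) 0 ord0 = b * r.
  by rewrite XH' stereo_inv_head dot0l sub0r addr0 divr1 mulrN1 mulNr opprK.
have XHn x : X (H x) <> X (H' 0).
  by move=> /(congr1 (fun z : 'rV[R]_n.+1 => z 0 ord0)); rewrite XH'0 XH;
    apply/eqP; exact: stereo_inv_not_pole.
have injX : injective X.
  move=> p q; have [[x ->]|->] := cover p; have [[y ->]|->] := cover q => //.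
  - by rewrite !XH => /(stereo_inv_inj r0 b1) ->.
  - by move/XHn.
  - by move/esym/XHn.
exists X; split=> //.
- move=> U oU; exists (~` (X @` (~` U))).
    rewrite openC; apply: compact_closed; first exact: norm_hausdorff.
    apply: continuous_compact; first exact: continuous_subspaceT.
    apply: (@subclosed_compact _ _ A) => //; first exact: open_closedC.
    by rewrite AT.
  apply/seteqP; split=> y.
    by move=> [q Uq <-]; split; [exists q|move=> [p nUp /injX pq]; apply: nUp; rewrite pq].
  move=> [[q _ <-] nq]; exists q => //; apply: contrapT => nUq; apply: nq.
  by exists q.
- apply/seteqP; split=> y; first by move=> [q _ <-]; exact: Xr.
  move=> yr; have [yb|yb] := eqVneq (y 0 ord0) (b * r).
    exists (H' (stereo r (- b) y)) => //; rewrite XH' stereoK// yb -subr_eq0 mulNr opprK -mulr2n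
      mulrn_eq0.
    rewrite mulf_eq0 (gt_eqF r0) orbF; apply/eqP => b0.
    by move/eqP: b1; rewrite b0 mul0r eq_sym oner_eq0.
  by exists (H (stereo r b y)) => //; rewrite XH stereoK.
Qed.

End SphereCovering.

Theorem corollary6p2 (R : realType) (n : nat) (Sigma : riemannianManifold R n)
    (X : Sigma -> 'rV[R]_n.+1) (lambda rad : R) :
  (2 <= n)%N ->
  0 < lambda ->
  connected_manifold Sigma ->
  self_shrinker lambda X ->
  parabolic Sigma ->
  (forall p : Sigma, enorm (X p) <= rad) ->
  rad <= Num.sqrt (n%:R / lambda) ->
  isometric_to Sigma (@euclidean_sphere R n (Num.sqrt (n%:R / lambda))).
Proof.
move=> n2 l0 conn shr par hrad rle; have [cM iX _ _] := shr.
apply: (isometric_to_sphere n2 conn cM iX).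
  by rewrite sqrtr_gt0 divr_gt0// ltr0n (leq_trans _ n2).
exact: shrinker_norm rle.
Qed.
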